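(* For every $\kappa>0$ there exists $k=k(\kappa)>0$ such that for all finite sets $A,B\subset\mathbb{R}$ with $|A|^{\kappa}\le |B|$, writing $|A+A|=K|A|$, we have \[ |AB| \gg \frac{|A|\,|B|^{1/2+k}}{K^{4/3}}. \]
   Context: $A+A=\{a+a': a,a'\in A\}$ and $AB=\{ab: a\in A, b\in B\}$. The notation $X\gg Y$ means $X\ge cY$ for a positive constant $c$.
   Formalization: The case A={0} is excluded: there |A|=K=1 and |AB|=1 for every nonempty finite B, while |B|^{1/2+k} is unbounded, so the claim as written fails. *)

(* Defs.v *)
From HB Require Import structures.
From mathcomp Require Import all_boot all_order all_algebra.
From mathcomp Require Import finmap.
From mathcomp Require Import reals exp.

Set Implicit Arguments.
Unset Strict Implicit.
Unset Printing Implicit Defensive.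

Local Open Scope fset_scope.
Local Open Scope ring_scope.

Definition sumset (R : realType) (A B : {fset R}) : {fset R} :=
  [fset a + b | a in A, b in B].

Definition prodset (R : realType) (A B : {fset R}) : {fset R} :=
  [fset a * b | a in A, b in B].

(* Main.v *)
Require Import Defs.
From HB Require Import structures.
From mathcomp Require Import all_boot all_order all_algebra.
From mathcomp Require Import finmap.
From mathcomp Require Import reals exp.
From mathcomp Require Import zify ring lra.

Set Implicit Arguments.
Unset Strict Implicit.
Unset Printing Implicit Defensive.

Import Order.TTheory GRing.Theory Num.Theory.
Local Open Scope fset_scope.
Local Open Scope ring_scope.

(** The incidence bound for rich lines in a grid ([rich_lines]) yields Elekes's estimate
    $|A||B|^{1/2}\ll K|AB|$ ([elekes_product]). A power of $|B|$ is gained because this exponent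
    cannot be nearly attained: if $|A+A|\le Z|A|$ and $|AB|\le Z|B|^{1/2}|A|$ for sets of positive
    reals, then $|B|\le Z^m$ with $m$ absolute ([small_product_bound]). Given this, let $\nu=|B|^k$
    with $k$ small in terms of $m$. If $K>\nu^3$, Elekes's estimate is enough, since $K\nu\le
    K^{4/3}$. If $K\le\nu^3$, either $|AB|$ is large outright or the bound with $Z=400\nu^3$ makes
    $|B|$ bounded ([combine_bounds]).

    To prove [small_product_bound], ignore powers of $Z$ and suppose first that $|A|$ is well above
    $|B|^{1/2}$ ([large_set], [large_set_doubling]). Small $|AB|$ forces $A\cap lA$ to be large for
    many ratios $l=b'/b$, while incidences allow only about $|B|$ such $l$. Ruzsa's inequality
    carries these coincidences over to the popular differences $y$ of $A$, so about $|A||B|^{1/2}$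
    numbers $p$ have about $|B|^{1/2}$ factorisations $p=by$. Now $l(ab-p)=(a-y)(lb)$ lies in $AB$
    as soon as $a-y\in A$ and $lb\in B$. Hence the lines $u\mapsto l(u-p)$, about $|A||B|^{3/2}$ in
    number, each have about $|A||B|^{1/4}$ points in $AB\times AB$, which [rich_lines] permits only
    for bounded $|B|$.

    In the remaining case $|B|$ is about $|A|^2$ and $|AB|$ about $|B|$, so multiplicative Plünnecke
    makes $AA/AA$ have size about $|A|^2$ ([card_quot_prod]). A suitable set $V$ of differences
    $a-la'$ then has about $|A|^2$ elements, small doubling, and small product set with $A/A$; the
    first case applied to $V$ and $A/A$ bounds $|A|$ ([small_set]). *)

(** * Counting sums and Cauchy-Schwarz over fibres *)

Section Sums.
Variable R : realType.

Lemma sum_indicator (T : Type) (s : seq T) (P : pred T) :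
  \sum_(x <- s) (P x)%:R = (count P s)%:R :> R.
Proof.
elim: s => [|x s IH]; first by rewrite big_nil.
by rewrite big_cons IH /= natrD.
Qed.

Lemma sum_eq_indicator (T : eqType) (s : seq T) (v : T) :
  uniq s -> \sum_(u <- s) (v == u)%:R = (v \in s)%:R :> R.
Proof.
move=> us; rewrite sum_indicator -(count_uniq_mem v us).
by congr (_%:R); apply: eq_count => u /=; rewrite eq_sym.
Qed.

Lemma sum_const_seq (T : Type) (s : seq T) (c : R) :
  \sum_(x <- s) c = (size s)%:R * c.
Proof. by rewrite big_const_seq count_predT iter_addr_0 mulr_natl. Qed.

Lemma sum_le_const (T : eqType) (s : seq T) (f : T -> R) (c : R) :
  {in s, forall x, f x <= c} -> \sum_(x <- s) f x <= (size s)%:R * c.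
Proof.
by move=> h; rewrite -sum_const_seq big_seq [leRHS]big_seq; apply: ler_sum.
Qed.

Lemma sum_ge_const (T : eqType) (s : seq T) (f : T -> R) (c : R) :
  {in s, forall x, c <= f x} -> (size s)%:R * c <= \sum_(x <- s) f x.
Proof.
by move=> h; rewrite -sum_const_seq big_seq [leRHS]big_seq; apply: ler_sum.
Qed.

Lemma ler_sum_in (T : eqType) (s : seq T) (f g : T -> R) :
  {in s, forall x, f x <= g x} -> \sum_(x <- s) f x <= \sum_(x <- s) g x.
Proof. by move=> h; rewrite big_seq [leRHS]big_seq; apply: ler_sum. Qed.

Lemma sqr_sum_le (T : Type) (s : seq T) (f : T -> R) :
  (\sum_(x <- s) f x) ^+ 2 <= (size s)%:R * \sum_(x <- s) f x ^+ 2.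
Proof.
have: 0 <= \sum_(x <- s) \sum_(y <- s) (f x - f y) ^+ 2.
  by apply: sumr_ge0 => x _; apply: sumr_ge0 => y _; apply: sqr_ge0.
have -> : \sum_(x <- s) \sum_(y <- s) (f x - f y) ^+ 2 =
   2 * ((size s)%:R * \sum_(x <- s) f x ^+ 2) - 2 * (\sum_(x <- s) f x) ^+ 2.
  under eq_bigr => x _.
    under eq_bigr => y _ do rewrite sqrrB.
    rewrite big_split sumrB /= sum_const_seq.
    under [X in _ - X + _]eq_bigr => y _ do rewrite -mulr_natl.
    rewrite -mulr_sumr -mulr_sumr.
    over.
  rewrite big_split sumrB /= -mulr_sumr sum_const_seq -mulr_sumr -mulr_suml.
  by ring.
by lra.
Qed.

(** Squaring the weight of a fibre counts pairs inside it; every energy below arises from this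
    identity. *)
Lemma sum_sqr_fibre (I T : eqType) (s : seq I) (S : seq T) (f : I -> T)
    (w : I -> R) :
  uniq S -> {in s, forall i, f i \in S} ->
  \sum_(v <- S) (\sum_(i <- s) w i * (f i == v)%:R) ^+ 2 =
  \sum_(i <- s) \sum_(j <- s) w i * w j * (f i == f j)%:R.
Proof.
move=> uS fS.
under eq_bigr => v _ do rewrite expr2 big_distrlr /=.
rewrite exchange_big /= big_seq [RHS]big_seq; apply: eq_bigr => i si.
rewrite exchange_big /= big_seq [RHS]big_seq; apply: eq_bigr => j sj.
transitivity (\sum_(v <- S) w i * w j * (f i == f j)%:R * (f i == v)%:R).
  apply: eq_bigr => v _; rewrite mulrACA -!mulrA; congr (_ * (_ * _)).
  case: (f i =P v) => [->|]; last by rewrite !mulr0n ?mul0r ?mulr0.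
  by rewrite mul1r mulr1 eq_sym.
by rewrite -mulr_sumr sum_eq_indicator // fS // mulr1.
Qed.

                                            
Lemma sqr_sum_fibre (I T : eqType) (s : seq I) (S : seq T) (f : I -> T)
    (w : I -> R) :
  uniq S -> {in s, forall i, f i \in S} ->
  (\sum_(i <- s) w i) ^+ 2 <=
  (size S)%:R * \sum_(i <- s) \sum_(j <- s) w i * w j * (f i == f j)%:R.
Proof.
move=> uS fS.
have e1 : \sum_(i <- s) w i = \sum_(v <- S) \sum_(i <- s) w i * (f i == v)%:R.
  rewrite exchange_big /= big_seq [RHS]big_seq; apply: eq_bigr => i si.
  by rewrite -mulr_sumr sum_eq_indicator // fS // mulr1.
rewrite e1; apply: le_trans (sqr_sum_le _ _) _.
apply: ler_wpM2l; first exact: ler0n.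
by rewrite sum_sqr_fibre.
Qed.

(** Cauchy-Schwarz as a collision count: a large family mapped into a small set must collide
    often. *)
Lemma card_sqr_fibre (I T : eqType) (s : seq I) (S : seq T) (f : I -> T) :
  uniq S -> {in s, forall i, f i \in S} ->
  (size s)%:R ^+ 2 <=
  (size S)%:R * \sum_(i <- s) \sum_(j <- s) (f i == f j)%:R :> R.
Proof.
move=> uS fS; have := sqr_sum_fibre (fun=> 1) uS fS.
rewrite sum_const_seq mulr1 => /le_trans; apply.
apply: ler_wpM2l; first exact: ler0n.
by apply: ler_sum => i _; apply: ler_sum => j _; rewrite !mul1r.
Qed.

Lemma sum_split_lt (T : Type) (s : seq T) (f g : T -> R) (t : R) :
  \sum_(x <- s) g x = \sum_(x <- s | f x < t) g x + \sum_(x <- s | t <= f x) g x.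
Proof.
rewrite (bigID (fun x => f x < t)) /=; congr (_ + _).
by apply: eq_bigl => x; rewrite -leNgt.
Qed.

End Sums.

(** * Cutting a finite set of reals into blocks of consecutive elements *)

Section Cells.
Variable R : realType.
Implicit Types (X Y : seq R) (w : nat).

Definition rank X (x : R) : nat := count (fun z => z < x) X.
Definition cell X w (x : R) : nat := (rank X x %/ w)%N.

Lemma rank_le X x y : x <= y -> (rank X x <= rank X y)%N.
Proof. by move=> xy; apply: sub_count => z /= /lt_le_trans; apply. Qed.

Lemma rank_inj X : {in X &, injective (rank X)}.
Proof.
have H x y : x \in X -> x < y -> rank X x <> rank X y.
  move=> xX xy.
  have /seq.permP e := perm_to_rem xX.
  rewrite /rank !e /= ltxx xy.
  have : (rank (rem x X) x <= rank (rem x X) y)%N by apply/rank_le/ltW.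
  by rewrite /rank add0n add1n => h1 h2; rewrite h2 ltnn in h1.
move=> x y xX yX e; case: (ltgtP x y) => // xy; first by case: (H x y).
by case: (H y x).
Qed.

Lemma cell_le X w x y : x <= y -> (cell X w x <= cell X w y)%N.
Proof. by move=> xy; apply/leq_div2r/rank_le. Qed.

Lemma cell_max X w x : (cell X w x <= size X %/ w)%N.
Proof. exact/leq_div2r/count_size. Qed.

(** On [X] the rank is injective, and block [v] has its ranks among the [w] integers starting at
    [v * w]. *)
Lemma cell_fibre X w v : uniq X -> (0 < w)%N ->
  (count (fun x => cell X w x == v) X <= w)%N.
Proof.
move=> uX w0; rewrite -size_filter.
rewrite -(size_map (rank X)) -[leqRHS](size_iota (v * w)).
apply: uniq_leq_size.
  rewrite map_inj_in_uniq ?filter_uniq // => x y.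
  by rewrite !mem_filter => /andP[_ xX] /andP[_ yX]; apply: rank_inj.
move=> r /mapP[x]; rewrite mem_filter => /andP[/eqP <- _] ->; rewrite mem_iota.
rewrite /cell leq_divM /= [X in (X < _)%N](divn_eq (rank X x) w).
by rewrite ltn_add2l ltn_mod.
Qed.

Lemma cell_pairs X w : uniq X -> (0 < w)%N ->
  \sum_(x <- X) \sum_(x' <- X) (cell X w x == cell X w x')%:R
  <= (size X)%:R * w%:R :> R.
Proof.
move=> uX w0; apply: sum_le_const => x _.
rewrite (sum_indicator _ X (fun x' => cell X w x == cell X w x')) ler_nat.
rewrite (eq_count (a2 := fun x' => cell X w x' == cell X w x)) ?cell_fibre //.
Qed.

End Cells.

                                                    

(** * An elementary incidence bound for rich lines in a grid *)

Section Lines.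
Variable R : realType.

Definition line_card (X Y : seq R) (al be : R) : R :=
  \sum_(x <- X) (al * x + be \in Y)%:R.

Lemma line_card_ge0 X Y al be : 0 <= line_card X Y al be.
Proof. by apply: sumr_ge0 => x _; apply: ler0n. Qed.

Lemma line_card_leX X Y al be : line_card X Y al be <= (size X)%:R.
Proof.
rewrite -[leRHS]mulr1; apply: sum_le_const => x _.
by case: (_ \in _); rewrite ?lexx ?ler01.
Qed.

Lemma line_card_leY (X Y : seq R) al be : uniq X -> al != 0 ->
  line_card X Y al be <= (size Y)%:R.
Proof.
move=> uX al0; rewrite /line_card sum_indicator ler_nat -size_filter.
rewrite -(size_map (fun x => al * x + be)); apply: uniq_leq_size.
  by rewrite map_inj_uniq ?filter_uniq // => x y /addIr /(mulfI al0).
by move=> y /mapP[x]; rewrite mem_filter => /andP[h _] ->.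
Qed.

(** A single index for the grid cell that the line occupies at abscissa [x]. The second coordinate
    is reversed on nonincreasing lines so that both summands grow with [x]; the index takes at most
    $|X|/w+|Y|/v+1$ values. *)
Definition diag_cell (X Y : seq R) (w v : nat) (al be x : R) : nat :=
  (cell X w x + if (0 < al)%R then cell Y v (al * x + be)%R
                else size Y %/ v - cell Y v (al * x + be)%R)%N.

                                                                        
(** Both summands are monotone in the same direction along the line, so equal sums force equal
    summands. *)
Lemma diag_cell_inj (X Y : seq R) w v al be x x' :
  diag_cell X Y w v al be x = diag_cell X Y w v al be x' ->
  cell X w x = cell X w x' /\
  cell Y v (al * x + be) = cell Y v (al * x' + be).
Proof.
wlog xx' : x x' / x <= x'.
  move=> H; case: (leP x x') => [|/ltW] le e; first exact: H.
  by have [-> ->] := H _ _ le (esym e).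
rewrite /diag_cell; have h1 := cell_le X w xx'.
have h2 := cell_max Y v (al * x + be); have h3 := cell_max Y v (al * x' + be).
case: ltP => al0.
  have h4 : (cell Y v (al * x + be) <= cell Y v (al * x' + be))%N.
    by apply: cell_le; rewrite lerD2r ler_pM2l.
  move: h1 h2 h3 h4; move: (cell X w x) (cell X w x').
  move: (cell Y v _) (cell Y v _) (size Y %/ v)%N => a b c d e; lia.
have h4 : (cell Y v (al * x' + be) <= cell Y v (al * x + be))%N.
  by apply: cell_le; rewrite lerD2r; apply: ler_wnM2l.
move: h1 h2 h3 h4; move: (cell X w x) (cell X w x').
move: (cell Y v _) (cell Y v _) (size Y %/ v)%N => a b c d e; lia.
Qed.

(** Ordered pairs of distinct grid points on the line that share a cell, each point being
    represented by its abscissa. *)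
Definition line_pairs (X Y : seq R) (w v : nat) (al be : R) : R :=
  \sum_(x <- X) \sum_(x' <- X)
    [&& x != x', cell X w x == cell X w x', al * x + be \in Y,
        al * x' + be \in Y &
        cell Y v (al * x + be) == cell Y v (al * x' + be)]%:R.

(** Cauchy-Schwarz over the cells met by the line: collisions are either diagonal, giving
    [line_card], or proper, giving [line_pairs]. *)
Lemma line_card_sqr (X Y : seq R) w v al be : uniq X ->
  line_card X Y al be ^+ 2 <=
  (size X %/ w + size Y %/ v).+1%:R *
    (line_card X Y al be + line_pairs X Y w v al be).
Proof.
move=> uX; set m := (_ + _).+1.
pose T := [seq x <- X | al * x + be \in Y].
have kE : line_card X Y al be = (size T)%:R.
  by rewrite /line_card sum_indicator size_filter.
have cm : {in T, forall x, diag_cell X Y w v al be x \in iota 0 m}.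
  move=> x _; rewrite mem_iota /= add0n /m ltnS /diag_cell.
  have h1 := cell_max X w x; have h2 := cell_max Y v (al * x + be).
  by apply: leq_add => //; case: ifP => // _; apply: leq_subr.
rewrite {1}kE; have := card_sqr_fibre R (iota_uniq 0 m) cm.
rewrite size_iota => /le_trans; apply; apply: ler_wpM2l; first exact: ler0n.
rewrite /line_card /line_pairs -big_split /= big_filter [leLHS]big_mkcond /=.
apply: ler_sum_in => x xX.
case: ifP => xY; last first.
  by rewrite add0r; apply: sumr_ge0 => x' _; apply: ler0n.
(* The diagonal contribution 1 is spread out as a sum of indicators of [x == x'], so that the
   comparison can be made term by term in [x']. *)
rewrite -[1%:R]/(true%:R) -{2}xX -(sum_eq_indicator _ _ uX) -big_split /=.
rewrite big_filter [leLHS]big_mkcond /=; apply: ler_sum => x' _.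
case: ifP => xY'; last by rewrite addr_ge0.
case: eqP => [/diag_cell_inj[-> ->]|_]; last by rewrite addr_ge0.
by rewrite !eqxx /= ?andbT; case: eqP => _ /=; lra.
Qed.

(** Two points with distinct abscissas determine their line, so a pair of points in a common cell is
    counted for at most one line. It remains to count such pairs in the grid. *)
Lemma sum_line_pairs (X Y : seq R) (I : eqType) (s : seq I) (al be : I -> R)
    w v :
  uniq X -> uniq Y -> uniq s -> (0 < w)%N -> (0 < v)%N ->
  {in s &, forall i j, al i = al j -> be i = be j -> i = j} ->
  \sum_(i <- s) line_pairs X Y w v (al i) (be i) <=
  (size X)%:R * w%:R * ((size Y)%:R * v%:R).
Proof.
move=> uX uY us w0 v0 inj.
rewrite /line_pairs exchange_big /=.
apply: le_trans (ler_wpM2r _ (cell_pairs uX w0)); last first.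
  by rewrite mulr_ge0 ?ler0n.
rewrite mulr_suml; apply: ler_sum => x _.
rewrite exchange_big /= mulr_suml; apply: ler_sum => x' _.
case: (cell X w x == _); last first.
  by rewrite mul0r big1 // => i _; rewrite andbF.
rewrite mul1r; have [->|xx'] := eqVneq x x'.
  by rewrite big1 ?mulr_ge0 // => i _; rewrite eqxx.
apply: le_trans (cell_pairs uY v0).
rewrite /= sum_indicator -size_filter.
pose phi i := (al i * x + be i, al i * x' + be i).
rewrite -(size_map phi).
have -> : \sum_(y <- Y) \sum_(y' <- Y) (cell Y v y == cell Y v y')%:R =
  (size [seq p <- [seq (y, y') | y <- Y, y' <- Y] |
      cell Y v p.1 == cell Y v p.2])%:R :> R.
  by rewrite size_filter -sum_indicator big_allpairs.
rewrite ler_nat; apply: uniq_leq_size.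
  rewrite map_inj_in_uniq ?filter_uniq // => i j.
  rewrite !mem_filter => /andP[_ si] /andP[_ sj] [e1 e2].
  have e3 : (al i - al j) * (x - x') = 0.
    by rewrite -[RHS](subrr (al j * x + be j)) -{1}e1 mulrBl !mulrBr; lra.
  have e4 : al i = al j.
    by move/eqP: e3; rewrite mulf_eq0 !subr_eq0 (negbTE xx') orbF => /eqP.
  by apply: inj => //; move: e1; rewrite e4 => /addrI.
move=> p /mapP[i]; rewrite mem_filter /= => /andP[/and3P[h1 h2 h3] _] ->.
rewrite mem_filter /= h3 /=.
by apply/allpairsP; exists (al i * x + be i, al i * x' + be i).
Qed.

                                                                            
                           
(** A Szemerédi-Trotter type bound for grids. The cells are made so wide that a line meets at most
    $t/2$ of them; for a line with at least $t$ points the diagonal term of [line_card_sqr] is then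
    absorbed, and its squared count is at most $t$ times its pairs in common cells. Nonzero slopes
    ensure $t\le|Y|$ whenever a rich line exists. *)
Lemma rich_lines (X Y : seq R) (I : eqType) (s : seq I) (al be : I -> R)
    (t : R) :
  uniq X -> uniq Y -> uniq s -> {in s, forall i, al i != 0} ->
  {in s &, forall i j, al i = al j -> be i = be j -> i = j} ->
  4 <= t ->
  t * \sum_(i <- s | t <= line_card X Y (al i) (be i))
         line_card X Y (al i) (be i) ^+ 2
  <= 81 * (size X)%:R ^+ 2 * (size Y)%:R ^+ 2.
Proof.
move=> uX uY us al0 inj t4.
have rhs0 : 0 <= 81 * (size X)%:R ^+ 2 * (size Y)%:R ^+ 2 :> R.
  by rewrite !mulr_ge0 ?exprn_ge0 ?ler0n.
have [/hasP[i0 i0s ti0]|/hasPn none] :=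
  boolP (has (fun i => t <= line_card X Y (al i) (be i)) s); last first.
  by rewrite big_seq_cond big1 ?mulr0 // => i /andP[/none /negbTE ->].
have tX : t <= (size X)%:R by apply: le_trans ti0 (line_card_leX _ _ _ _).
have tY : t <= (size Y)%:R.
  by apply: le_trans ti0 (line_card_leY _ _ uX (al0 _ i0s)).
have t0 : 0 < t by lra.
have width (n : nat) : t <= n%:R ->
  exists2 w : nat, (0 < w)%N & (n %/ w)%:R * 8 <= t /\ w%:R * t <= 9 * n%:R.
  (* The width is $8n/t$ rounded up past the next integer; as $t\le n$, the rounding adds at most
     $n$ to $wt$, hence the constant 9. *)
  move=> tn; pose w := (Num.truncn (8 * n%:R / t)).+1.
  have n0 : 0 <= n%:R :> R by exact: ler0n.
  have q0 : 0 <= 8 * n%:R / t by rewrite divr_ge0 ?mulr_ge0 // ltW.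
  have /andP[lo hi] := truncn_itv q0.
  exists w => //; split.
    have h1 : (n %/ w)%:R * w%:R <= n%:R :> R by rewrite -natrM ler_nat leq_divM.
    have h2 : 8 * n%:R <= w%:R * t by rewrite -ler_pdivrMr // ltW.
    have d0 : 0 <= (n %/ w)%:R :> R by exact: ler0n.
    have w0 : 0 < w%:R :> R by rewrite ltr0n.
    rewrite -(ler_pM2r w0); nra.
  have : w%:R <= 8 * n%:R / t + 1 by rewrite /w -natr1 lerD2r.
  by rewrite -(ler_pM2r t0) mulrDl divfK ?gt_eqF //; lra.
have [w w0 [w1 w2]] := width _ tX; have [v v0 [v1 v2]] := width _ tY.
(* Here $4\le t$ enters: $t/8+t/8+1\le t/2$. *)
have m_le : 2 * (size X %/ w + size Y %/ v).+1%:R <= t.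
  by rewrite -addn1 !natrD; lra.
have step i : t <= line_card X Y (al i) (be i) ->
    line_card X Y (al i) (be i) ^+ 2 <= t * line_pairs X Y w v (al i) (be i).
  move=> tk; have := line_card_sqr Y w v (al i) (be i) uX.
  have p0 : 0 <= line_pairs X Y w v (al i) (be i).
    by apply: sumr_ge0 => x _; apply: sumr_ge0 => x' _; apply: ler0n.
  move: tk m_le p0; move: (line_card _ _ _ _) (line_pairs _ _ _ _ _ _).
  move: _.+1%:R => m k p tk m_le p0; nra.
have main : \sum_(i <- s | t <= line_card X Y (al i) (be i))
      line_card X Y (al i) (be i) ^+ 2 <=
    t * ((size X)%:R * w%:R * ((size Y)%:R * v%:R)).
  apply: le_trans (_ : t * \sum_(i <- s) line_pairs X Y w v (al i) (be i) <= _).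
    rewrite mulr_sumr [leLHS]big_mkcond; apply: ler_sum => i _.
    case: ifP => [|_]; first exact: step.
    rewrite mulr_ge0 ?(ltW t0) //.
    by apply: sumr_ge0 => x _; apply: sumr_ge0 => x' _; apply: ler0n.
  by rewrite ler_pM2l // sum_line_pairs.
apply: le_trans (ler_wpM2l (ltW t0) main) _.
have -> : t * (t * ((size X)%:R * w%:R * ((size Y)%:R * v%:R))) =
   ((size X)%:R * (size Y)%:R) * ((w%:R * t) * (v%:R * t)) by ring.
have -> : 81 * (size X)%:R ^+ 2 * (size Y)%:R ^+ 2 =
   ((size X)%:R * (size Y)%:R) * ((9 * (size X)%:R) * (9 * (size Y)%:R)) :> R
   by ring.
apply: ler_wpM2l; first by rewrite mulr_ge0 ?ler0n.
by apply: ler_pM; rewrite ?mulr_ge0 ?ler0n ?(ltW t0).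
Qed.

End Lines.

                                    

(** * Sum and difference sets: Ruzsa's triangle inequality and Petridis's lemma *)

Section Sets.
Variable R : realType.
Implicit Types (A B C X Y Z : {fset R}) (l : R).

Definition diffset A B : {fset R} := [fset a - b | a in A, b in B].
Definition dilate l A : {fset R} := [fset l * a | a in A].

Lemma sumsetP A B x :
  reflect (exists a b, [/\ a \in A, b \in B & x = a + b]) (x \in sumset A B).
Proof.
apply: (iffP (imfset2P _ _ _ _ _)) => [[a /= aA [b bB ->]]|[a [b [aA bB ->]]]].
  by exists a, b.
by exists a => //; exists b.
Qed.

Lemma diffsetP A B x :
  reflect (exists a b, [/\ a \in A, b \in B & x = a - b]) (x \in diffset A B).
Proof.
apply: (iffP (imfset2P _ _ _ _ _)) => [[a /= aA [b bB ->]]|[a [b [aA bB ->]]]].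
  by exists a, b.
by exists a => //; exists b.
Qed.

Lemma prodsetP A B x :
  reflect (exists a b, [/\ a \in A, b \in B & x = a * b]) (x \in prodset A B).
Proof.
apply: (iffP (imfset2P _ _ _ _ _)) => [[a /= aA [b bB ->]]|[a [b [aA bB ->]]]].
  by exists a, b.
by exists a => //; exists b.
Qed.

Lemma dilateP l A x : reflect (exists2 a, a \in A & x = l * a) (x \in dilate l A).
Proof. exact: (iffP (imfsetP _ _ _ _)). Qed.

Lemma mem_sumset A B a b : a \in A -> b \in B -> a + b \in sumset A B.
Proof. by move=> aA bB; apply/sumsetP; exists a, b. Qed.

Lemma mem_diffset A B a b : a \in A -> b \in B -> a - b \in diffset A B.
Proof. by move=> aA bB; apply/diffsetP; exists a, b. Qed.

Lemma mem_prodset A B a b : a \in A -> b \in B -> a * b \in prodset A B.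
Proof. by move=> aA bB; apply/prodsetP; exists a, b. Qed.

Lemma sumsetS A A' B B' : A `<=` A' -> B `<=` B' -> sumset A B `<=` sumset A' B'.
Proof.
move=> /fsubsetP sA /fsubsetP sB; apply/fsubsetP => x /sumsetP[a [b [aA bB ->]]].
by apply: mem_sumset; auto.
Qed.

Lemma prodsetS A A' B B' :
  A `<=` A' -> B `<=` B' -> prodset A B `<=` prodset A' B'.
Proof.
move=> /fsubsetP sA /fsubsetP sB; apply/fsubsetP => x /prodsetP[a [b [aA bB ->]]].
by apply: mem_prodset; auto.
Qed.

Lemma sumset_dilate l A B : sumset (dilate l A) (dilate l B) = dilate l (sumset A B).
Proof.
apply/fsetP => x; apply/sumsetP/dilateP.
  move=> [_ [_ [/dilateP[a aA ->] /dilateP[b bB ->] ->]]].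
  by exists (a + b); rewrite ?mulrDr ?mem_sumset.
move=> [_ /sumsetP[a [b [aA bB ->]]] ->]; exists (l * a), (l * b).
by rewrite mulrDr; split => //; apply/dilateP; [exists a | exists b].
Qed.

Lemma sumset0 A : sumset A fset0 = fset0.
Proof.
apply/fsetP => x; rewrite [RHS]inE.
by apply/negP => /sumsetP[a [b [_]]]; rewrite inE.
Qed.

Lemma card_dilate l A : l != 0 -> #|` dilate l A| = #|` A|.
Proof. by move=> l0; apply: card_imfset => x y /(mulfI l0). Qed.

Lemma card_image2_le (T : choiceType) (f : R -> R -> T) A B :
  (#|` [fset f a b | a in A, b in B]| <= #|` A| * #|` B|)%N.
Proof.
have /fsubset_leq_card /leq_trans : [fset f a b | a in A, b in B] `<=`
    [fset x in [seq f a b | a <- A, b <- B]].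
  apply/fsubsetP => x /imfset2P[a /= aA [b bB ->]].
  by rewrite inE; apply/allpairsP; exists (a, b).
apply; rewrite -[leqRHS](size_allpairs f).
by apply: uniq_leq_size => // x; rewrite inE.
Qed.

(** Fix for each difference $d$ one representation $d=x-y$. The map $(d,z)\mapsto(x+z,y+z)$ is
    injective, because the difference of its coordinates recovers $d$. *)
Lemma ruzsa X Y Z :
  (#|` diffset X Y| * #|` Z| <= #|` sumset X Z| * #|` sumset Y Z|)%N.
Proof.
(* The default 0 is never returned when [d] is a difference: the list is then nonempty. *)
pose y d := head 0 [seq y <- Y | d + y \in X].
have yP d : d \in diffset X Y -> y d \in Y /\ d + y d \in X.
  move=> /diffsetP[a [b [aX bY ->]]].
  suff : y (a - b) \in [seq y <- Y | a - b + y \in X].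
    by rewrite mem_filter => /andP[].
  have : b \in [seq y <- Y | a - b + y \in X] by rewrite mem_filter subrK aX.
  by rewrite /y; case: [seq _ <- _ | _] => //= u s _; rewrite inE eqxx.
pose phi (p : R * R) := (p.1 + y p.1 + p.2, y p.1 + p.2).
pose s := [seq (d, z) | d <- diffset X Y, z <- Z].
pose t := [seq (d, z) | d <- sumset X Z, z <- sumset Y Z].
have <- : size (map phi s) = (#|` diffset X Y| * #|` Z|)%N.
  by rewrite size_map size_allpairs.
have <- : size t = (#|` sumset X Z| * #|` sumset Y Z|)%N by rewrite size_allpairs.
apply: uniq_leq_size.
  rewrite map_inj_uniq; first by apply: allpairs_uniq => // -[a b] [c d] _ _ [-> ->].
  move=> [d z] [d' z'] [/= e1 e2].
  have e3 : d = d' by rewrite -!addrA e2 in e1; apply: addIr e1.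
  by congr (_, _) => //; move: e2; rewrite e3 => /addrI.
move=> _ /mapP[_ /allpairsP[[d z] /= [dD zZ ->]] ->].
have [h1 h2] := yP d dD.
by apply/allpairsP; exists (phi (d, z)); split => //=; apply: mem_sumset.
Qed.

Lemma seq_argmin (T : eqType) (s : seq T) (f : T -> R) : s != [::] ->
  exists2 x, x \in s & {in s, forall y, f x <= f y}.
Proof.
elim: s => // x s IH _; have [->|/IH[y ys hy]] := eqVneq s [::].
  by exists x => [|z]; rewrite inE // => /eqP ->.
have [xy|yx] := leP (f x) (f y).
  exists x => [|z]; first by rewrite inE eqxx.
  by rewrite inE => /orP[/eqP ->//|/hy]; apply: le_trans.
exists y => [|z]; first by rewrite inE ys orbT.
by rewrite inE => /orP[/eqP ->|/hy //]; apply: ltW.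
Qed.

                                                                               
                
(** $X$ minimises $|X+A|/|X|$ over the nonempty subsets of $B$. The last inequality is proved by
    adding the elements of $C$ one at a time, comparing with the minimality of $X$ on a suitable
    subset; it replaces Plünnecke's inequality. *)
Lemma petridis A B : B != fset0 ->
  exists X, [/\ X `<=` B, X != fset0,
    (#|` sumset X A| * #|` B| <= #|` sumset B A| * #|` X|)%N &
    forall C, (#|` sumset (sumset X A) C| * #|` X| <=
               #|` sumset X A| * #|` sumset X C|)%N].
Proof.
move=> B0; pose s := [seq X <- fpowerset B | X != fset0].
pose f (X : {fset R}) := #|` sumset X A|%:R / #|` X|%:R : R.
have BS : B \in s by rewrite mem_filter B0 fpowersetE fsubset_refl.
have s0 : s != [::] by apply/eqP => e; rewrite e in BS.
have [X] := seq_argmin f s0; rewrite mem_filter fpowersetE => /andP[X0 XB] Xmin.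
have Xmin' Y : Y `<=` X -> (#|` sumset X A| * #|` Y| <= #|` sumset Y A| * #|` X|)%N.
  move=> YX; have [->|Y0] := eqVneq Y fset0; first by rewrite cardfs0 muln0.
  have /Xmin : Y \in s by rewrite mem_filter Y0 fpowersetE (fsubset_trans YX).
  have hX : 0 < #|` X|%:R :> R by rewrite ltr0n cardfs_gt0.
  have hY : 0 < #|` Y|%:R :> R by rewrite ltr0n cardfs_gt0.
  rewrite /f ler_pdivrMr // mulrAC ler_pdivlMr //.
  by rewrite -!natrM ler_nat.
exists X; split => //.
  have hX : 0 < #|` X|%:R :> R by rewrite ltr0n cardfs_gt0.
  have hY : 0 < #|` B|%:R :> R by rewrite ltr0n cardfs_gt0.
  have := Xmin _ BS; rewrite /f ler_pdivrMr // mulrAC ler_pdivlMr //.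
  by rewrite -!natrM ler_nat.
elim/fset1U_rect => [|c C _ IH]; first by rewrite !sumset0 cardfs0 mul0n.
set C' := c |` C.
have C'E x : (x \in C') = (x == c) || (x \in C) by rewrite !inE.
(* For these $x$ the translate by $c$ is not new in $X+C$, and correspondingly $X_2+A+c$ is not new
   in $X+A+C$. Minimality gives $|X+A||X_2|\le|X_2+A||X|$, which balances the two savings. *)
pose X2 := [fset x in X | x + c \in sumset X C].
have X2X : X2 `<=` X by apply/fsubsetP => x; rewrite !inE => /andP[].
have h1 : (#|` sumset (sumset X A) C'| + #|` sumset X2 A| <=
   #|` sumset (sumset X A) C| + #|` sumset X A|)%N.
  pose E := [fset x + c | x in sumset X A `\` sumset X2 A].
  have sub : sumset (sumset X A) C' `<=` sumset (sumset X A) C `|` E.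
    apply/fsubsetP => _ /sumsetP[y [c' [yXA c'C ->]]]; rewrite inE.
    move: c'C; rewrite C'E => /orP[/eqP ->|c'C]; last by rewrite mem_sumset.
    have [y2|y2] := boolP (y \in sumset X2 A); last first.
      by apply/orP; right; apply/imfsetP; exists y => //=; rewrite !inE y2.
    apply/orP; left; move/sumsetP: y2 => [x [a [xX2 aA ->]]].
    move: xX2; rewrite !inE => /andP[_ /sumsetP[x' [d [x'X dC e]]]].
    have -> : x + a + c = x' + a + d by rewrite addrAC e addrAC.
    by apply: mem_sumset => //; apply: mem_sumset.
  have := leq_trans (fsubset_leq_card sub) (leq_card_fsetU _ _).
  have -> : #|` E| = #|` sumset X A `\` sumset X2 A|.
    by apply: card_imfset; apply: addIr.
  have := cardfsD (sumset X A) (sumset X2 A).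
  have sub2 : sumset X2 A `<=` sumset X A by apply: sumsetS.
  have -> : sumset X A `&` sumset X2 A = sumset X2 A by apply/fsetIidPr.
  have := fsubset_leq_card sub2; lia.
have h2 : (#|` sumset X C| + #|` X| <= #|` sumset X C'| + #|` X2|)%N.
  pose E := [fset x + c | x in X `\` X2].
  have sub : sumset X C `|` E `<=` sumset X C'.
    apply/fsubsetP => y; rewrite inE => /orP[/sumsetP[x [d [xX dC ->]]]|].
      by apply: mem_sumset => //; rewrite C'E dC orbT.
    move=> /imfsetP[x /=]; rewrite !inE => /andP[_ xX] ->.
    by apply: mem_sumset => //; rewrite C'E eqxx.
  have dis : sumset X C `&` E = fset0.
    apply/fsetP => y; rewrite !inE; apply/negP => /andP[yXC /imfsetP[x /=]].
    by rewrite !inE => /andP[/negP nx xX] e; apply: nx; rewrite xX /= -e.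
  have := fsubset_leq_card sub; have := cardfsUI (sumset X C) E.
  rewrite dis cardfs0.
  have -> : #|` E| = #|` X `\` X2| by apply: card_imfset; apply: addIr.
  have := cardfsD X X2; have -> : X `&` X2 = X2 by apply/fsetIidPr.
  have := fsubset_leq_card X2X; lia.
have h3 := Xmin' _ X2X.
have h4 := leq_mul h1 (leqnn #|` X|); have h5 := leq_mul (leqnn #|` sumset X A|) h2.
rewrite !mulnDl in h4; rewrite !mulnDr in h5; lia.
Qed.

End Sets.

                            

(** * Energies of dilates and the sizes of the intersections of A with its dilates *)

Section Energy.
Variable R : realType.
Implicit Types (A B : {fset R}) (l : R) (La : seq R).

(** The additive energy between $A$ and $lA$. *)
Definition energy A l : R :=
  \sum_(a <- A) \sum_(b <- A) \sum_(c <- A) \sum_(d <- A)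
    (a + l * b == c + l * d)%:R.

(** For $l\ne0$ this is $|A\cap lA|$; if moreover $0\notin A$, it is the number of ways to write $l$
    as a quotient of two elements of $A$. *)
Definition ratio_card A l : R := \sum_(a <- A) (l * a \in A)%:R.

Lemma energy_ge0 A l : 0 <= energy A l.
Proof. by do 4 (apply: sumr_ge0 => ? _); apply: ler0n. Qed.

Lemma ratio_card_ge0 A l : 0 <= ratio_card A l.
Proof. by apply: sumr_ge0 => ? _; apply: ler0n. Qed.

Lemma energy_diff A l : energy A l =
  \sum_(a <- A) \sum_(b <- A) \sum_(c <- A) \sum_(d <- A)
    (a - l * b == c - l * d)%:R.
Proof.
rewrite /energy; apply: eq_bigr => a _.
under eq_bigr => b _ do rewrite exchange_big /=.
rewrite exchange_big /=; apply: eq_bigr => d _.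
rewrite exchange_big /=; apply: eq_bigr => c _; apply: eq_bigr => b _.
by rewrite -subr_eq0 -[in RHS]subr_eq0; congr (_ == _)%:R; ring.
Qed.

Lemma energy_lower A l :
  #|` A|%:R ^+ 4 <= #|` diffset A (dilate l A)|%:R * energy A l.
Proof.
pose s := [seq (a, b) | a <- A, b <- A].
pose f (p : R * R) := p.1 - l * p.2.
have fS : {in s, forall p, f p \in diffset A (dilate l A)}.
  move=> p /allpairsP[[a b] /= [aA bA ->]]; apply: mem_diffset => //.
  by apply/dilateP; exists b.
have := card_sqr_fibre R (fset_uniq _) fS.
rewrite size_allpairs natrM -expr2 -exprM => /le_trans; apply.
rewrite ler_wpM2l ?ler0n // energy_diff /s big_allpairs /=.
by do 2 (apply: ler_sum => ? _); rewrite big_allpairs.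
Qed.

(** With $Z=A\cap lA$, both $A+Z$ and $lA+Z$ have at most $|A+A|$ elements, so Ruzsa's inequality
    gives $|A-lA||Z|\le|A+A|^2$. Combine with the lower bound for the energy in terms of
    $|A-lA|$. *)
Lemma ratio_card_energy A l : l != 0 ->
  #|` A|%:R ^+ 4 * ratio_card A l <= #|` sumset A A|%:R ^+ 2 * energy A l.
Proof.
move=> l0; pose Z := [fset l * a | a in [fset a in A | l * a \in A]].
have cZ : ratio_card A l = #|` Z|%:R.
  rewrite /ratio_card sum_indicator card_imfset /=; last by move=> x y /(mulfI l0).
  congr (_%:R); rewrite -size_filter; apply/eqP; rewrite eqn_leq.
  apply/andP; split; apply: uniq_leq_size; rewrite ?filter_uniq ?fset_uniq //.
    by move=> x; rewrite mem_filter !inE andbC.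
  by move=> x; rewrite mem_filter !inE andbC.
have h1 : Z `<=` A.
  by apply/fsubsetP => y /imfsetP[a /=]; rewrite !inE => /andP[_ h] ->.
have h2 : Z `<=` dilate l A.
  apply/fsubsetP => y /imfsetP[a /=]; rewrite !inE => /andP[h _] ->.
  by apply/dilateP; exists a.
have h3 := ruzsa A (dilate l A) Z.
have h4 : (#|` sumset A Z| <= #|` sumset A A|)%N.
  exact/fsubset_leq_card/sumsetS.
have h5 : (#|` sumset (dilate l A) Z| <= #|` sumset A A|)%N.
  rewrite -(card_dilate (sumset A A) l0) -sumset_dilate.
  exact/fsubset_leq_card/sumsetS.
have h6 : #|` diffset A (dilate l A)|%:R * #|` Z|%:R <= #|` sumset A A|%:R ^+ 2 :> R.
  by rewrite expr2 -!natrM ler_nat; apply: leq_trans h3 (leq_mul h4 h5).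
rewrite cZ; apply: le_trans (ler_wpM2r (energy_ge0 _ _) h6).
by rewrite [leRHS]mulrAC ler_wpM2r ?ler0n ?energy_lower.
Qed.

(** $E(A,l)$ is the second moment of the incidence counts of $A\times A$ with the lines of slope
    $-l$. Poor lines are bounded by $t$ times the first moment $|A|^2$ for each $l$, rich ones by
    [rich_lines]. *)
Lemma sum_energy A La t : uniq La -> {in La, forall l, l != 0} -> 4 <= t ->
  t * \sum_(l <- La) energy A l <=
  t ^+ 2 * (size La)%:R * #|` A|%:R ^+ 2 + 81 * #|` A|%:R ^+ 4.
Proof.
move=> uLa La0 t4; have t0 : 0 < t by lra.
pose C := undup [seq a + lb | a <- A, lb <- [seq l * b | l <- La, b <- A]].
have CE l a b : l \in La -> a \in A -> b \in A -> a + l * b \in C.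
  move=> lL aA bA; rewrite mem_undup; apply/allpairsP; exists (a, l * b).
  by split => //; apply/allpairsP; exists (l, b).
pose k l c := line_card A A (- l) c.
have kE l c : k l c = \sum_(p <- [seq (a, b) | a <- A, b <- A])
    1 * (p.1 + l * p.2 == c)%:R.
  rewrite big_allpairs exchange_big /=; apply: eq_bigr => b _.
  rewrite -(sum_eq_indicator _ _ (fset_uniq A)); apply: eq_bigr => a _.
  rewrite mul1r; congr ((nat_of_bool _)%:R).
  by apply/eqP/eqP => <-; ring.
have fC l : l \in La -> {in [seq (a, b) | a <- A, b <- A],
    forall p, p.1 + l * p.2 \in C}.
  by move=> lL p /allpairsP[[a b] /= [aA bA ->]]; apply: CE.
have eE l : l \in La -> energy A l = \sum_(c <- C) k l c ^+ 2.
  move=> lL; under eq_bigr => c _ do rewrite kE.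
  rewrite (sum_sqr_fibre _ (undup_uniq _) (fC l lL)) big_allpairs.
  do 2 (apply: eq_bigr => ? _); rewrite big_allpairs.
  by do 2 (apply: eq_bigr => ? _); rewrite !mul1r.
have mass l : l \in La -> \sum_(c <- C) k l c = #|` A|%:R ^+ 2.
  move=> lL; under eq_bigr => c _ do rewrite kE.
  rewrite exchange_big /=.
  rewrite big_seq; under eq_bigr => p ps.
    rewrite -mulr_sumr sum_eq_indicator ?undup_uniq // (fC l lL) // mul1r.
    over.
  by rewrite -big_seq sum_const_seq mulr1 size_allpairs natrM.
pose s := [seq (l, c) | l <- La, c <- C].
have -> : \sum_(l <- La) energy A l = \sum_(p <- s) k p.1 p.2 ^+ 2.
  by rewrite big_allpairs big_seq [RHS]big_seq; apply: eq_bigr.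
rewrite (sum_split_lt _ (fun p => k p.1 p.2) _ t) mulrDr; apply: lerD.
  rewrite expr2 -!mulrA ler_pM2l //.
  apply: le_trans (_ : \sum_(p <- s) t * k p.1 p.2 <= _).
    rewrite [leLHS]big_mkcond; apply: ler_sum => p _.
    have k0 : 0 <= k p.1 p.2 by apply: line_card_ge0.
    by case: ifP => [/ltW h|_]; [rewrite expr2 ler_wpM2r | rewrite mulr_ge0 // ltW].
  rewrite -mulr_sumr ler_pM2l // /s big_allpairs.
  by apply: sum_le_const => l lL; rewrite mass.
have := @rich_lines R A A _ s (fun p => - p.1) snd t.
rewrite -mulrA -exprD; apply; rewrite ?fset_uniq //.
- by apply: allpairs_uniq; rewrite ?undup_uniq // => -[a b] [c d] _ _ [-> ->].
- by move=> p /allpairsP[[l c] /= [lL _ ->]]; rewrite oppr_eq0 La0.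
- by move=> [l c] [l' c'] _ _ /= /oppr_inj -> ->.
Qed.

Lemma sum_ratio_card_triv A La : uniq La -> 0 \notin A ->
  \sum_(l <- La) ratio_card A l <= #|` A|%:R ^+ 2.
Proof.
move=> uLa A0; rewrite /ratio_card exchange_big /= expr2.
apply: sum_le_const => a aA.
have a0 : a != 0 by apply: contraNneq A0 => <-.
rewrite (sum_indicator _ La (fun l => l * a \in A)) ler_nat -size_filter.
rewrite -(size_map (fun l => l * a)); apply: uniq_leq_size.
  by rewrite map_inj_uniq ?filter_uniq // => x y /(mulIf a0).
by move=> y /mapP[l]; rewrite mem_filter => /andP[h _] ->.
Qed.

(** Energies dominate the intersections, and their sum is controlled by incidences. When the optimal
    threshold $t$ falls below 4, the set of ratios is so large that the trivial bound $|A|^2$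
    suffices. *)
Lemma sum_ratio_card A La (K : R) : uniq La -> {in La, forall l, l != 0} ->
  0 \notin A -> 1 <= K -> #|` sumset A A|%:R <= K * #|` A|%:R ->
  \sum_(l <- La) ratio_card A l <=
  18 * K ^+ 2 * #|` A|%:R * Num.sqrt (size La)%:R.
Proof.
move=> uLa La0 A0 K1 dbl.
set n := #|` A|%:R; set q : R := Num.sqrt _.
have q0 : 0 <= q by apply: sqrtr_ge0.
have n0 : 0 <= n by apply: ler0n.
have qq : q ^+ 2 = (size La)%:R by rewrite sqr_sqrtr ?ler0n.
have K2 : 1 <= K ^+ 2 by rewrite exprn_ege1.
have triv := sum_ratio_card_triv uLa A0.
have [small|big] := ltP (9 * n) (4 * q).
  apply: (le_trans triv); rewrite -/n.
  apply: le_trans (_ : 1 * n * (18 * q) <= _); last first.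
    rewrite -[leRHS]/(18 * K ^+ 2 * n * q).
    have -> : 18 * K ^+ 2 * n * q = K ^+ 2 * n * (18 * q) by ring.
    by rewrite ler_wpM2r ?mulr_ge0 // ler_wpM2r.
  by nra.
have [q00|qn0] := eqVneq q 0.
  have -> : La = [::].
    by apply/eqP; rewrite -size_eq0 -(eqr_nat R) -qq q00 expr0n.
  by rewrite big_nil !mulr_ge0 // ltW // (lt_le_trans ltr01).
have qp : 0 < q by rewrite lt_def qn0 q0.
have np : 0 < n by nra.
(* This choice makes the two terms of [sum_energy] equal. *)
pose t := 9 * n / q.
have tq : t * q = 9 * n by rewrite /t divfK.
have t4 : 4 <= t by rewrite /t ler_pdivlMr.
clearbody t.
have := sum_energy A uLa La0 t4; rewrite -/n -qq.
have -> : t ^+ 2 * q ^+ 2 * n ^+ 2 + 81 * n ^+ 4 = t * (q * (n ^+ 3 * 18)).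
  by rewrite -exprMn mulrA tq; ring.
have tp : 0 < t by lra.
rewrite ler_pM2l // => sE.
have n3 : 0 < n ^+ 2 by rewrite exprn_gt0.
have bd l : l \in La -> n ^+ 2 * ratio_card A l <= K ^+ 2 * energy A l.
  move=> lL; rewrite -(ler_pM2l n3) mulrA -exprD.
  apply: le_trans (ratio_card_energy A (La0 _ lL)) _.
  rewrite mulrA -exprMn [n * K]mulrC; apply: ler_wpM2r; first exact: energy_ge0.
  by rewrite ler_pXn2r // nnegrE ?ler0n // mulr_ge0 // ltW // (lt_le_trans ltr01).
have : n ^+ 2 * \sum_(l <- La) ratio_card A l <= K ^+ 2 * \sum_(l <- La) energy A l.
  by rewrite !mulr_sumr; apply: ler_sum_in.
move=> h; rewrite -(ler_pM2l n3); apply: (le_trans h).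
apply: le_trans (_ : K ^+ 2 * (q * (n ^+ 3 * 18)) <= _).
  by apply: ler_wpM2l sE; lra.
by rewrite le_eqVlt; apply/orP; left; apply/eqP; ring.
Qed.

                                                                                    
(** Elekes's argument: for $b\in G$ and $a\in A$, the line $x\mapsto b(x-a)$ passes through
    $(a+a',ba')$ for every $a'\in A$ with $ba'\in U$, so it has at least $q$ points in $(A+A)\times
    U$. *)
Lemma elekes A (U : {fset R}) (G : seq R) (q : R) : uniq G ->
  {in G, forall b, b != 0} -> 4 <= q ->
  {in G, forall b, q <= \sum_(a <- A) (b * a \in U)%:R} ->
  (size G)%:R * #|` A|%:R * q ^+ 3 <=
  81 * #|` sumset A A|%:R ^+ 2 * #|` U|%:R ^+ 2.
Proof.
move=> uG G0 q4 hq; pose s := [seq (b, a) | b <- G, a <- A].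
have q0 : 0 < q by lra.
have := @rich_lines R (sumset A A) U _ s fst (fun p => - p.1 * p.2) q.
move=> /(_ _ _ _ _ _ q4) h; apply: le_trans (h _ _ _ _ _); rewrite ?fset_uniq //; last first.
- move=> [b a] [b' a'] /allpairsP[[? ?] /= [bG _ [-> ->]]] _ /= <-.
  by rewrite !mulNr => /oppr_inj /(mulfI (G0 _ bG)) ->.
- by move=> p /allpairsP[[b a] /= [bG _ ->]]; apply: G0.
- by apply: allpairs_uniq; rewrite // => -[a b] [c d] _ _ [-> ->].
rewrite exprS mulrCA; apply: ler_wpM2l; first exact: ltW.
rewrite -natrM -(size_allpairs pair) -/s.
have rich : {in s, forall p, q <= line_card (sumset A A) U p.1 (- p.1 * p.2)}.
  move=> p /allpairsP[[b a] /= [bG aA ->]]; apply: le_trans (hq _ bG) _ => /=.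
  rewrite /line_card !sum_indicator ler_nat -!size_filter.
  rewrite -(size_map (fun x => x + a)); apply: uniq_leq_size.
    by rewrite (map_inj_uniq (addIr a)) filter_uniq ?fset_uniq.
  move=> y /mapP[x]; rewrite mem_filter => /andP[h1 xA] ->.
  rewrite mem_filter mem_sumset // andbT.
  by rewrite (_ : _ + _ = b * x) //; ring.
rewrite -sum_const_seq big_seq [leRHS]big_seq_cond.
apply: le_trans (_ : \sum_(i <- s | i \in s)
    line_card (sumset A A) U i.1 (- i.1 * i.2) ^+ 2 <= _).
  apply: ler_sum => p ps; rewrite ler_pXn2r ?nnegrE ?(ltW q0) ?line_card_ge0 //.
  exact: rich.
rewrite le_eqVlt; apply/orP; left; apply/eqP; apply: eq_bigl => p.
by case ps: (p \in s) => //=; rewrite rich.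
Qed.

End Energy.

(** * Multiplicative energy and popular differences *)

Section Popular.
Variable R : realType.
Implicit Types (A B D U : {fset R}) (l : R).

Lemma sum_eq_mul (T : eqType) (s : seq T) (v : T) (g : T -> R) :
  uniq s -> v \in s -> \sum_(u <- s) (v == u)%:R * g u = g v.
Proof.
move=> us vs; under eq_bigr => u _.
  rewrite (_ : _ * _ = g v * (v == u)%:R); last first.
    by case: eqP => [->|_]; rewrite ?mul0r ?mulr0 // mulrC.
  over.
by rewrite -mulr_sumr sum_eq_indicator // vs mulr1.
Qed.

(** The double sum counts the solutions of $ab=a'b'$, so this is Cauchy-Schwarz for the
    multiplication map into $U$. *)
Lemma prod_energy A (G : seq R) U : uniq G -> {in G, forall b, b != 0} ->
  {in A & G, forall a b, a * b \in U} ->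
  ((size G)%:R * #|` A|%:R) ^+ 2 <=
  #|` U|%:R * \sum_(b <- G) \sum_(b' <- G) ratio_card A (b' / b).
Proof.
move=> uG G0 hU; pose s := [seq (b, a) | b <- G, a <- A].
have fS : {in s, forall p : R * R, p.2 * p.1 \in U}.
  by move=> p /allpairsP[[b a] /= [bG aA ->]]; apply: hU.
have := card_sqr_fibre R (fset_uniq U) fS.
rewrite size_allpairs natrM => /le_trans; apply.
rewrite ler_wpM2l ?ler0n // big_allpairs /=.
apply: ler_sum_in => b bG; under eq_bigr => a _ do rewrite big_allpairs.
rewrite exchange_big /=; apply: ler_sum => b' _.
rewrite exchange_big /=; apply: ler_sum => a' _.
rewrite -(sum_eq_indicator _ _ (fset_uniq A)); apply: ler_sum => a _.
rewrite ler_nat; case: eqP => // e; rewrite (_ : _ == a) //; apply/eqP.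
by rewrite mulrAC [b' * a']mulrC -e mulfK // G0.
Qed.

Definition diff_card A (y : R) : R := \sum_(a <- A) (a - y \in A)%:R.

Lemma diff_card_ge0 A y : 0 <= diff_card A y.
Proof. by apply: sumr_ge0 => a _; apply: ler0n. Qed.

Lemma diff_card_le A y : diff_card A y <= #|` A|%:R.
Proof.
rewrite -[leRHS]mulr1; apply: sum_le_const => a _.
by case: (_ \in _); rewrite ?lexx ?ler01.
Qed.

Lemma diff_card_eq0 A y : y \notin diffset A A -> diff_card A y = 0.
Proof.
move=> yD; rewrite /diff_card big_seq big1 // => a aA.
rewrite (_ : _ \in A = false) //; apply/negP => h.
by case/negP: yD; rewrite -[y](subKr a) mem_diffset.
Qed.

(** Rewrite $a+lb=c+ld$ as $a-c=l(d-b)$ and group by $y=d-b$. *)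
Lemma energy_diff_card A l :
  energy A l = \sum_(y <- diffset A A) diff_card A y * diff_card A (l * y).
Proof.
transitivity (\sum_(d <- A) \sum_(b <- A) diff_card A (l * (d - b))).
  rewrite /energy; under eq_bigr => a _ do under eq_bigr => b _ do
    rewrite exchange_big /=.
  under eq_bigr => a _ do rewrite exchange_big /=.
  rewrite exchange_big /=; apply: eq_bigr => d _.
  rewrite exchange_big /=; apply: eq_bigr => b _; apply: eq_bigr => a _.
  rewrite -(sum_eq_indicator _ _ (fset_uniq A)); apply: eq_bigr => c _.
  congr ((nat_of_bool _)%:R).
  by apply/eqP/eqP => [e|<-]; [rewrite -[RHS](addrK (l * d)) -e|]; ring.
symmetry; under eq_bigr => y _.
  rewrite /diff_card; under eq_bigr => a _.
    rewrite -(sum_eq_indicator _ _ (fset_uniq A)).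
    under eq_bigr => a' _.
      rewrite (_ : (a - y == a') = (a - a' == y)); last first.
        by apply/eqP/eqP => <-; ring.
      over.
    over.
  rewrite mulr_suml; under eq_bigr => a _ do rewrite mulr_suml.
  over.
rewrite exchange_big /=; apply: eq_big_seq => a aA.
rewrite exchange_big /=; apply: eq_big_seq => a' a'A.
by rewrite (sum_eq_mul (fun y => diff_card A (l * y))) ?mem_diffset ?fset_uniq.
Qed.

(** Zero is left out so that products of these differences with nonzero numbers can serve as
    slopes. *)
Definition popdiff A (eta : R) : {fset R} :=
  [fset y in diffset A A | (y != 0) && (eta * #|` A|%:R <= diff_card A y)].

Lemma popdiffP A eta y : reflect
  [/\ y \in diffset A A, y != 0 & eta * #|` A|%:R <= diff_card A y]
  (y \in popdiff A eta).
Proof. by rewrite /popdiff !inE /=; apply: and3P. Qed.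

(** A large $A\cap lA$ forces large energy $E(A,l)$, that is, a large correlation of the difference
    counts at $y$ and $ly$. The term $y=0$ and the unpopular differences account for at most
    $E/4+E/8$ of it, so popular $y$ with popular $ly$ carry more than half. *)
Lemma popular_common A l (K eta : R) : l != 0 -> A != fset0 ->
  1 <= K -> 0 <= eta -> eta * K ^+ 6 <= 1 / 8 ->
  #|` sumset A A|%:R <= K * #|` A|%:R ->
  #|` sumset A (diffset A A)|%:R <= K ^+ 3 * #|` A|%:R ->
  4 * K ^+ 2 <= ratio_card A l ->
  ratio_card A l <= 2 * K ^+ 2 *
    \sum_(y <- popdiff A eta) (l * y \in popdiff A eta)%:R.
Proof.
move=> l0 A0 K1 eta0 etaK dbl tpl big.
set Dp := popdiff A eta; set J := \sum_(_ <- _) _.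
set n := #|` A|%:R in dbl tpl *.
have np : 0 < n by rewrite ltr0n cardfs_gt0.
have K2 : 1 <= K ^+ 2 by rewrite exprn_ege1.
set E := energy A l; have E0 : 0 <= E by apply: energy_ge0.
pose D := diffset A A.
pose Zc := \sum_(y <- D) (l * y \in D)%:R : R.
have uD : uniq (D : seq R) by apply: fset_uniq.
have JD : J = \sum_(y <- D) ((y \in Dp) && (l * y \in Dp))%:R.
  rewrite /J !sum_indicator; congr (_%:R).
  rewrite -!size_filter; apply: perm_size; apply: uniq_perm.
  - by rewrite filter_uniq ?fset_uniq.
  - by rewrite filter_uniq.
  move=> y; rewrite !mem_filter; case yDp: (y \in Dp); rewrite /= ?andbF //.
  by rewrite andbT; case/popdiffP: yDp => -> _ _; rewrite andbT.
(* The three terms come from $y=0$, from pairs $y,ly\in D$ of which one is unpopular, and from pairs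
   of popular differences. *)
have upper : E <= n ^+ 2 + eta * n ^+ 2 * Zc + n ^+ 2 * J.
  have -> : n ^+ 2 + eta * n ^+ 2 * Zc + n ^+ 2 * J =
    \sum_(y <- D) ((0 == y)%:R * n ^+ 2 + eta * n ^+ 2 * (l * y \in D)%:R +
       n ^+ 2 * ((y \in Dp) && (l * y \in Dp))%:R).
    rewrite !big_split /= -!mulr_sumr -JD -/Zc; congr (_ + _ + _).
    rewrite (sum_eq_mul (fun=> n ^+ 2)) //.
    by have [a aA] := fset0Pn _ A0; rewrite -(subrr a) mem_diffset.
  rewrite /E energy_diff_card; apply: ler_sum_in => y yD.
  have r1 := diff_card_ge0 A y; have r2 := diff_card_ge0 A (l * y).
  have r3 := diff_card_le A y; have r4 := diff_card_le A (l * y).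
  rewrite -/n in r3 r4; have n2 : 0 <= n ^+ 2 by rewrite exprn_ge0 // ltW.
  have prod : diff_card A y * diff_card A (l * y) <= n ^+ 2.
    by rewrite expr2; apply: ler_pM.
  have [lyD|lyD] := boolP (l * y \in D); last first.
    by rewrite (diff_card_eq0 lyD) mulr0 !addr_ge0 ?mulr_ge0 ?ler0n.
  rewrite mulr1.
  have [y0|y0] := eqVneq 0 y.
    rewrite mul1r; apply: (le_trans prod); rewrite -addrA lerDl.
    by rewrite addr_ge0 ?mulr_ge0 ?ler0n.
  rewrite mul0r add0r.
  have [yP|yP] := boolP (y \in Dp); last first.
    have h : diff_card A y <= eta * n.
      rewrite leNgt; apply/negP => /ltW h; case/negP: yP.
      by apply/popdiffP; rewrite eq_sym.
    by rewrite mulr0 addr0 expr2 mulrA; apply: ler_pM.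
  have [lyP|lyP] := boolP (l * y \in Dp); last first.
    have h : diff_card A (l * y) <= eta * n.
      rewrite leNgt; apply/negP => /ltW h; case/negP: lyP.
      by apply/popdiffP; rewrite mulf_neq0 // eq_sym.
    by rewrite mulr0 addr0 expr2 mulrA mulrC; apply: ler_pM.
  by rewrite mulr1; apply: (le_trans prod); rewrite lerDr mulr_ge0.
(* Ruzsa's inequality for $A$, $lA$ and $D\cap lD$ gives $|A-lA||D\cap lD|\le|A+D|^2$;
   [energy_lower] then trades $|A-lA|$ for the energy. *)
have Zc_le : n ^+ 2 * Zc <= K ^+ 6 * E.
  pose Z := [fset l * y | y in [fset y in D | l * y \in D]].
  have cZ : Zc = #|` Z|%:R.
    rewrite /Zc sum_indicator card_imfset /=; last by move=> x y /(mulfI l0).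
    congr (_%:R); rewrite -size_filter; apply: perm_size; apply: uniq_perm.
    - by rewrite filter_uniq.
    - exact: fset_uniq.
    by move=> x; rewrite mem_filter !inE andbC.
  have h1 : Z `<=` D.
    by apply/fsubsetP => x /imfsetP[a /=]; rewrite !inE => /andP[_ h] ->.
  have h2 : Z `<=` dilate l D.
    apply/fsubsetP => x /imfsetP[a /=]; rewrite !inE => /andP[h _] ->.
    by apply/dilateP; exists a.
  have h3 := ruzsa A (dilate l A) Z.
  have h4 : (#|` sumset A Z| <= #|` sumset A D|)%N.
    exact/fsubset_leq_card/sumsetS.
  have h5 : (#|` sumset (dilate l A) Z| <= #|` sumset A D|)%N.
    rewrite -(card_dilate (sumset A D) l0) -sumset_dilate.
    exact/fsubset_leq_card/sumsetS.
  have h6 : #|` diffset A (dilate l A)|%:R * #|` Z|%:R <= #|` sumset A D|%:R ^+ 2 :> R.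
    by rewrite expr2 -!natrM ler_nat; apply: leq_trans h3 (leq_mul h4 h5).
  have h7 : #|` sumset A D|%:R ^+ 2 <= K ^+ 6 * n ^+ 2.
    rewrite (_ : _ * _ = (K ^+ 3 * n) ^+ 2); last by ring.
    by rewrite ler_pXn2r // nnegrE ?ler0n // mulr_ge0 ?exprn_ge0 ?(ltW np) //; lra.
  have h8 := energy_lower A l; rewrite -/n -/E in h8.
  have n2 : 0 < n ^+ 2 by rewrite exprn_gt0.
  rewrite -(ler_pM2l n2) mulrA -exprD cZ.
  apply: (le_trans (ler_wpM2r (ler0n _ _) h8)); rewrite mulrAC.
  apply: (le_trans (ler_wpM2r E0 h6)); rewrite mulrA [n ^+ 2 * _]mulrC.
  exact: ler_wpM2r.
have low : n ^+ 2 * ratio_card A l <= K ^+ 2 * E.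
  have n2 : 0 < n ^+ 2 by rewrite exprn_gt0.
  rewrite -(ler_pM2l n2) mulrA -exprD.
  apply: (le_trans (ratio_card_energy A l0)); rewrite mulrA -exprMn [n * K]mulrC.
  apply: ler_wpM2r => //.
  by rewrite ler_pXn2r // nnegrE ?ler0n // mulr_ge0 // ?ltW //; lra.
have n2 : 0 < n ^+ 2 by rewrite exprn_gt0.
have E4 : 4 * n ^+ 2 <= E.
  have Kp : 0 < K ^+ 2 by lra.
  rewrite -(ler_pM2l Kp); apply: le_trans low.
  have -> : K ^+ 2 * (4 * n ^+ 2) = n ^+ 2 * (4 * K ^+ 2) by ring.
  by rewrite ler_pM2l.
have mid : eta * n ^+ 2 * Zc <= 1 / 8 * E.
  rewrite -mulrA; apply: (le_trans (ler_wpM2l eta0 Zc_le)).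
  by rewrite mulrA; apply: ler_wpM2r.
have EJ : E <= 2 * (n ^+ 2 * J) by lra.
rewrite -(ler_pM2l n2); apply: (le_trans low).
have -> : n ^+ 2 * (2 * K ^+ 2 * J) = K ^+ 2 * (2 * (n ^+ 2 * J)) by ring.
by apply: ler_wpM2l EJ; lra.
Qed.

Definition fibre_card (G : seq R) (Dp : {fset R}) (p : R) : R :=
  \sum_(b <- G) (p / b \in Dp)%:R.

Lemma fibre_card_ge0 G Dp p : 0 <= fibre_card G Dp p.
Proof. by apply: sumr_ge0 => b _; apply: ler0n. Qed.

                                                           
(** A factorisation $p=by$ puts the point $(b^{-1},y+a)$ on the line of slope $p$ and intercept $a$.
    Each $p$ with a large fibre thus gives $|A|$ rich lines in $G^{-1}\times(A+D)$, whence the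
    factor $|A|$ on the left. *)
Lemma fibre_tail A D (G P : seq R) (Dp : {fset R}) (t : R) :
  uniq G -> uniq P -> {in P, forall p, p != 0} -> Dp `<=` D -> 4 <= t ->
  t * (#|` A|%:R *
    \sum_(p <- P | t <= fibre_card G Dp p) fibre_card G Dp p ^+ 2) <=
  81 * (size G)%:R ^+ 2 * #|` sumset A D|%:R ^+ 2.
Proof.
move=> uG uP P0 /fsubsetP DpD t4; pose F := fibre_card G Dp.
pose s := [seq (p, a) | p <- P, a <- A].
pose X := [seq b^-1 | b <- G].
have uX : uniq X by rewrite map_inj_uniq //; apply: invr_inj.
have Fk p a : a \in A -> F p <= line_card X (sumset A D) p a.
  move=> aA; rewrite /line_card big_map; apply: ler_sum => b _.
  rewrite ler_nat; case h: (_ \in Dp) => //.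
  by rewrite addrC mem_sumset // DpD.
have := @rich_lines R X (sumset A D) _ s fst snd t uX (fset_uniq _).
rewrite size_map => /(_ _ _ _ t4) h; apply: le_trans (h _ _ _).
- rewrite ler_pM2l; last by lra.
  rewrite /s [leRHS]big_mkcond big_allpairs [X in _ * X]big_mkcond mulr_sumr.
  apply: ler_sum => p _; rewrite -sum_const_seq; apply: ler_sum_in => a aA /=.
  have Fpa := Fk p a aA.
  case: ifP => tF.
    by rewrite (le_trans tF Fpa) ler_pXn2r // nnegrE ?line_card_ge0 ?fibre_card_ge0.
  by case: ifP => // _; rewrite exprn_ge0 // line_card_ge0.
- by apply: allpairs_uniq; rewrite ?fset_uniq // => -[a b] [c d] _ _ [-> ->].
- by move=> p /allpairsP[[b a] /= [bP _ ->]]; apply: P0.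
- by move=> [l c] [l' c'] _ _ /= -> ->.
Qed.

End Popular.

                                                

(** * The case of A well above the square root of |B| *)

Section LargeSet.
(** The single parameter $Z$ measures every loss, absolute constants being absorbed through
    $Z\ge100$; $S$ is $|B|^{1/2}$, and the aim is to bound it by a power of $Z$. *)
Variables (R : realType) (A B : {fset R}) (Z S : R).
Local Notation n := (#|` A|%:R : R).
Local Notation N := (#|` B|%:R : R).
Hypotheses (Z100 : 100 <= Z) (Sgt0 : 0 < S) (SN : S ^+ 2 = N).
Hypotheses (A0 : 0 \notin A) (Bpos : {in B, forall b, 0 < b}).
Hypotheses (dbl : #|` sumset A A|%:R <= Z * n)
  (tpl : #|` sumset (sumset A A) A|%:R <= Z ^+ 2 * n)
  (prd : #|` prodset A B|%:R <= Z * S * n) (large : Z ^+ 5 * S <= n).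

Let Z0 : 0 < Z. Proof. by move: Z100; lra. Qed.
Let Z1 : 1 <= Z. Proof. by move: Z100; lra. Qed.
Let n0 : 0 < n.
Proof. by apply: lt_le_trans large; rewrite mulr_gt0 ?exprn_gt0. Qed.
Let B0 : {in B, forall b, b != 0}.
Proof. by move=> b /Bpos; rewrite lt_def => /andP[]. Qed.

Let rA := ratio_card A.

Lemma sum_ratioZ (La : seq R) : uniq La -> {in La, forall l, l != 0} ->
  \sum_(l <- La) rA l <= Z ^+ 3 * n * Num.sqrt (size La)%:R.
Proof.
have z100 := Z100; have z0 := Z0; have s0 := Sgt0; have np := n0.
move=> uLa La0; apply: le_trans (sum_ratio_card uLa La0 A0 Z1 dbl) _.
rewrite ler_wpM2r ?sqrtr_ge0 // ler_wpM2r ?ler0n // [Z ^+ 3]exprS.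
by apply: ler_wpM2r; [rewrite exprn_ge0 // ltW | lra].
Qed.

(** The threshold $n/(2ZS)$ is half the lower bound that [prod_energy_sub] gives for the average of
    [rA] over the quotients $b'/b$. *)
Definition good_ratio (l : R) : bool := n <= rA l * (2 * Z * S).
Definition ratios : seq R :=
  [seq l <- undup [seq b' / b | b <- B, b' <- B] | good_ratio l].
Definition deg (b : R) : nat := count (fun b' => good_ratio (b' / b)) B.

Lemma ratios_uniq : uniq ratios.
Proof. by rewrite filter_uniq ?undup_uniq. Qed.

Lemma mem_ratios b b' : b \in B -> b' \in B -> good_ratio (b' / b) ->
  b' / b \in ratios.
Proof.
move=> bB bB' g; rewrite mem_filter g mem_undup.
by apply/allpairsP; exists (b, b').
Qed.

Lemma ratios_gt0 l : l \in ratios -> 0 < l.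
Proof.
rewrite mem_filter mem_undup => /andP[_ /allpairsP[[b b'] /= [bB bB' ->]]].
by rewrite divr_gt0 // Bpos.
Qed.

Lemma ratios_neq0 : {in ratios, forall l, l != 0}.
Proof. by move=> l /ratios_gt0; rewrite lt_def => /andP[]. Qed.

(** Each good ratio adds at least $n/(2ZS)$ to a sum that grows only like the square root of their
    number. *)
Lemma size_ratios : (size ratios)%:R <= Z ^+ 9 * S ^+ 2.
Proof.
have z100 := Z100; have z0 := Z0; have s0 := Sgt0; have np := n0.
set q : R := Num.sqrt (size ratios)%:R.
have q0 : 0 <= q by apply: sqrtr_ge0.
have qq : q ^+ 2 = (size ratios)%:R by rewrite sqr_sqrtr ?ler0n.
have h1 : (size ratios)%:R * n <= \sum_(l <- ratios) rA l * (2 * Z * S).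
  by apply: sum_ge_const => l; rewrite mem_filter => /andP[].
rewrite -mulr_suml in h1.
have ZS : 0 <= 2 * Z * S by rewrite !mulr_ge0 // ltW.
have h2 := le_trans h1 (ler_wpM2r ZS (sum_ratioZ ratios_uniq ratios_neq0)).
rewrite -/q -qq in h2 *.
have h3 : q * q <= q * (2 * Z ^+ 4 * S).
  rewrite -(ler_pM2r n0) -expr2; apply: (le_trans h2).
  by rewrite le_eqVlt; apply/orP; left; apply/eqP; ring.
have h4 : q <= 2 * Z ^+ 4 * S.
  have [->|qn0] := eqVneq q 0; first by rewrite !mulr_ge0 ?exprn_ge0 // ltW.
  by rewrite ler_pM2l in h3 => //; rewrite lt_def qn0.
apply: le_trans (_ : (2 * Z ^+ 4 * S) ^+ 2 <= _).
  by rewrite ler_pXn2r // nnegrE // (le_trans q0 h4).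
have -> : (2 * Z ^+ 4 * S) ^+ 2 = 4 * (Z ^+ 8 * S ^+ 2) by ring.
rewrite [Z ^+ 9]exprS -mulrA; apply: ler_wpM2r; last by lra.
by rewrite mulr_ge0 ?exprn_ge0 // ltW.
Qed.

Lemma prod_energy_sub (C : {fset R}) : C `<=` B ->
  #|` C|%:R ^+ 2 * n <=
  Z * S * \sum_(b <- C) \sum_(b' <- C) rA (b' / b).
Proof.
move=> /fsubsetP CB.
have T0 : 0 <= \sum_(b <- C) \sum_(b' <- C) rA (b' / b).
  by do 2 (apply: sumr_ge0 => ? _); apply: ratio_card_ge0.
have h := @prod_energy R A C (prodset A B) (fset_uniq _)
  (fun b bC => B0 (CB b bC)) (fun a b aA bC => mem_prodset aA (CB b bC)).
rewrite -(ler_pM2r n0); apply: le_trans (_ : (#|` C|%:R * n) ^+ 2 <= _).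
  by rewrite exprMn -mulrA -expr2.
apply: (le_trans h); apply: (le_trans (ler_wpM2r T0 prd)).
by rewrite mulrAC.
Qed.

(** Bad ratios carry at most half of the multiplicative energy. For fixed $b$ the good ones are
    [deg b] distinct numbers, so [sum_ratioZ] bounds their share by the square root of the
    degree. *)
Lemma sum_deg : S ^+ 3 <= 2 * Z ^+ 4 * \sum_(b <- B) Num.sqrt (deg b)%:R.
Proof.
have z100 := Z100; have z0 := Z0; have s0 := Sgt0; have np := n0.
set T1 := \sum_(b <- B) _; set T := \sum_(b <- B) \sum_(b' <- B) rA (b' / b).
have h1 : N ^+ 2 * n <= Z * S * T by apply: prod_energy_sub; apply: fsubset_refl.
have ZS : 0 < 2 * Z * S by rewrite !mulr_gt0.
have row b : b \in B -> 2 * Z * S * \sum_(b' <- B) rA (b' / b) <=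
    N * n + 2 * Z * S * (Z ^+ 3 * n * Num.sqrt (deg b)%:R).
  move=> bB; rewrite (bigID (fun b' => good_ratio (b' / b))) /= mulrDr addrC.
  apply: lerD.
    rewrite mulr_sumr [leLHS]big_mkcond; apply: sum_le_const => b' _.
    case: ifP => [|_]; last exact: ltW.
    by rewrite /good_ratio -ltNge mulrC => /ltW.
  rewrite ler_pM2l //.
  have := @sum_ratioZ [seq b' / b | b' <- B & good_ratio (b' / b)].
  rewrite big_map big_filter size_map size_filter; apply.
    rewrite map_inj_uniq ?filter_uniq ?fset_uniq //.
    by apply: mulIf; rewrite invr_eq0 B0.
  move=> l /mapP[b']; rewrite mem_filter => /andP[_ b'B] ->.
  by rewrite mulf_neq0 ?invr_eq0 ?B0.
have h2 : 2 * Z * S * T <= N * (N * n) + 2 * Z * S * (Z ^+ 3 * n * T1).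
  rewrite mulr_sumr mulr_sumr mulr_sumr -sum_const_seq -big_split /=.
  exact: ler_sum_in.
have h3 : N ^+ 2 * n <= 2 * Z * S * (Z ^+ 3 * n * T1) by nra.
have Sn : 0 < S * n by rewrite mulr_gt0.
rewrite -(ler_pM2r Sn).
have -> : S ^+ 3 * (S * n) = N ^+ 2 * n by rewrite -SN; ring.
by apply: (le_trans h3); rewrite le_eqVlt; apply/orP; left; apply/eqP; ring.
Qed.

Definition rich_mult : {fset R} :=
  [fset b in B | S <= Num.sqrt (deg b)%:R * Z ^+ 5].
Local Notation N1 := (#|` rich_mult|%:R : R).

Lemma rich_mult_sub : rich_mult `<=` B.
Proof. by apply/fsubsetP => b; rewrite !inE => /andP[]. Qed.

Lemma card_rich_mult : S ^+ 2 <= N1 * Z ^+ 5.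
Proof.
have z100 := Z100; have z0 := Z0; have s0 := Sgt0; have np := n0.
have sd b : Num.sqrt (deg b)%:R <= S.
  rewrite -(ger0_norm (ltW Sgt0)) -sqrtr_sqr ler_wsqrtr // SN ler_nat.
  exact: count_size.
have Z5 : 0 < Z ^+ 5 by rewrite exprn_gt0.
have N1E : N1 = \sum_(b <- B) (S <= Num.sqrt (deg b)%:R * Z ^+ 5)%R%:R.
  rewrite sum_indicator -size_filter; congr (_%:R); apply: perm_size.
  apply: uniq_perm; rewrite ?filter_uniq ?fset_uniq // => b.
  by rewrite mem_filter !inE andbC.
have h1 : Z ^+ 5 * \sum_(b <- B) Num.sqrt (deg b)%:R <= N * S + N1 * (Z ^+ 5 * S).
  rewrite N1E mulr_sumr mulr_suml -sum_const_seq -big_split /=.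
  apply: ler_sum => b _; have := sd b; set d := Num.sqrt _ => dS.
  have [h|h] /= := leP S (d * Z ^+ 5); last by rewrite mul0r addr0 mulrC ltW.
  rewrite mul1r; apply: le_trans (_ : Z ^+ 5 * S <= _); first by rewrite ler_pM2l.
  by rewrite lerDr ltW.
have h2 := sum_deg; move: h1 h2; set T := \sum_(b <- B) _ => h1 h2.
have h3 : Z * S ^+ 3 <= 2 * (N * S + N1 * (Z ^+ 5 * S)).
  apply: le_trans (ler_wpM2l (ltW Z0) h2) _.
  rewrite (_ : Z * _ = 2 * (Z ^+ 5 * T)); last by ring. 
  exact: ler_wpM2l.
have h4 : Z * S ^+ 2 <= 2 * (S ^+ 2 + N1 * Z ^+ 5).
  rewrite -(ler_pM2r Sgt0) (_ : Z * S ^+ 2 * S = Z * S ^+ 3); last by ring.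
  by apply: (le_trans h3); rewrite -SN le_eqVlt; apply/orP; left; apply/eqP; ring.
have S2 : 0 < S ^+ 2 by rewrite exprn_gt0.
have h5 : 100 * S ^+ 2 <= Z * S ^+ 2 by rewrite ler_pM2r.
lra.
Qed.

Lemma deg_rich b : b \in rich_mult -> S ^+ 2 <= (deg b)%:R * Z ^+ 10.
Proof.
rewrite !inE => /andP[_ h].
have -> : (deg b)%:R * Z ^+ 10 = (Num.sqrt (deg b)%:R * Z ^+ 5) ^+ 2.
  by rewrite exprMn sqr_sqrtr ?ler0n // -exprM.
by rewrite ler_pXn2r // nnegrE ?mulr_ge0 ?sqrtr_ge0 ?exprn_ge0 // ltW.
Qed.

Let D := diffset A A.
(** The exponent 7 gives $Z^{-7}Z^6=1/Z\le1/8$, as [popular_common] requires with $K=Z$. *)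
Let Dp := popdiff A (Z ^- 7).
Let F := fibre_card rich_mult Dp.
Let Pa := prodset rich_mult Dp.

Lemma card_diff : #|` D|%:R <= Z ^+ 2 * n.
Proof.
rewrite -(ler_pM2r n0) -natrM.
apply: le_trans (_ : #|` sumset A A|%:R ^+ 2 <= _).
  by rewrite expr2 -natrM ler_nat ruzsa.
rewrite (_ : Z ^+ 2 * n * n = (Z * n) ^+ 2); last by ring.
by rewrite ler_pXn2r // nnegrE ?ler0n // mulr_ge0 // ltW.
Qed.

Lemma card_sum_diff : #|` sumset A D|%:R <= Z ^+ 3 * n.
Proof.
have sub : sumset A D `<=` diffset (sumset A A) A.
  apply/fsubsetP => x /sumsetP[a [y [aA /diffsetP[b [c [bA cA ->]]] ->]]].
  by rewrite addrA mem_diffset // mem_sumset.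
apply: le_trans (_ : #|` diffset (sumset A A) A|%:R <= _).
  by rewrite ler_nat fsubset_leq_card.
rewrite -(ler_pM2r n0) -natrM.
apply: le_trans (_ : #|` sumset (sumset A A) A|%:R * #|` sumset A A|%:R <= _).
  by rewrite -natrM ler_nat ruzsa.
rewrite (_ : Z ^+ 3 * n * n = (Z ^+ 2 * n) * (Z * n)); last by ring.
by apply: ler_pM; rewrite ?ler0n.
Qed.

(** The multiplicative energy passes from $A$ to its popular differences: by [popular_common],
    $|A\cap lA|$ is at most $4Z^2$ plus $2Z^2$ times the number of $y\in D_p$ with $ly\in D_p$, and
    over $l=b'/b$ these numbers count the solutions of $by'=b'y$. The additive $4Z^2$ is harmless
    because $n\ge Z^5S$. *)
Lemma sum_fibre_sqr : n * N1 ^+ 2 <= 4 * Z ^+ 3 * S * \sum_(p <- Pa) F p ^+ 2.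
Proof.
have z100 := Z100; have z0 := Z0; have s0 := Sgt0; have np := n0.
have h1 := prod_energy_sub rich_mult_sub.
pose J l : R := \sum_(y <- Dp) (l * y \in Dp)%:R.
have J0 l : 0 <= J l by apply: sumr_ge0 => y _; apply: ler0n.
have etaK : Z ^- 7 * Z ^+ 6 <= 1 / 8.
  rewrite (_ : Z ^- 7 * Z ^+ 6 = Z^-1); last by field; rewrite gt_eqF.
  by rewrite -(ler_pM2r Z0) mulVf ?gt_eqF //; lra.
have An0 : A != fset0 by rewrite -cardfs_gt0 -(ltr0n R).
have rJ l : l != 0 -> rA l <= 4 * Z ^+ 2 + 2 * Z ^+ 2 * J l.
  move=> l0; have Z2 : 0 <= Z ^+ 2 by rewrite exprn_ge0 // ltW.
  have [h|h] := leP (4 * Z ^+ 2) (rA l); last first.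
    by apply: (le_trans (ltW h)); rewrite lerDl !mulr_ge0 ?J0 // ltW.
  have eta0 : 0 <= Z ^- 7 by rewrite invr_ge0 exprn_ge0 // ltW.
  have := popular_common l0 An0 Z1 eta0 etaK dbl card_sum_diff h.
  rewrite -/Dp -/(J l) => /le_trans; apply; rewrite lerDr.
  by rewrite mulr_ge0.
have SJ : \sum_(b <- rich_mult) \sum_(b' <- rich_mult) J (b' / b) <=
    \sum_(p <- Pa) F p ^+ 2.
  under [leRHS]eq_bigr => p _ do rewrite expr2 big_distrlr /=.
  rewrite [leRHS]exchange_big /=; apply: ler_sum_in => b bB.
  rewrite [leRHS]exchange_big /=; apply: ler_sum_in => b' bB'.
  have b0 : b != 0 by apply/B0/(fsubsetP rich_mult_sub).
  have b'0 : b' != 0 by apply/B0/(fsubsetP rich_mult_sub).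
  under [leRHS]eq_bigr => p _ do rewrite -natrM mulnb.
  rewrite /J !sum_indicator ler_nat -!size_filter.
  rewrite -(size_map (fun y => b' * y)); apply: uniq_leq_size.
    by rewrite map_inj_uniq ?filter_uniq ?fset_uniq //; apply: mulfI.
  move=> p /mapP[y]; rewrite mem_filter => /andP[h yD] ->.
  rewrite mem_filter mem_prodset // andbT [b' * y / b]mulrAC h.
  by rewrite mulrAC mulfV // mul1r.
have SR : \sum_(b <- rich_mult) \sum_(b' <- rich_mult) rA (b' / b) <=
   4 * Z ^+ 2 * N1 ^+ 2 + 2 * Z ^+ 2 *
     \sum_(b <- rich_mult) \sum_(b' <- rich_mult) J (b' / b).
  have -> : 4 * Z ^+ 2 * N1 ^+ 2 =
      \sum_(b <- rich_mult) \sum_(b' <- rich_mult) (4 * Z ^+ 2).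
    by under eq_bigr => b _ do rewrite sum_const_seq; rewrite sum_const_seq; ring.
  rewrite mulr_sumr -big_split /=.
  apply: ler_sum_in => b bB; rewrite mulr_sumr -big_split /=.
  apply: ler_sum_in => b' bB'; apply: rJ.
  by rewrite mulf_neq0 ?invr_eq0 //; apply/B0/(fsubsetP rich_mult_sub).
set T := \sum_(p <- Pa) _ in SJ *.
have ZS : 0 < Z * S by rewrite mulr_gt0.
have h2 : N1 ^+ 2 * n <= Z * S * (4 * Z ^+ 2 * N1 ^+ 2 + 2 * Z ^+ 2 * T).
  apply: (le_trans h1); rewrite ler_pM2l //; apply: (le_trans SR).
  by rewrite lerD2l ler_wpM2l // mulr_ge0 // exprn_ge0 // ltW.
have h3 : 8 * (Z ^+ 3 * S) <= n.
  apply: le_trans large.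
  rewrite (_ : Z ^+ 5 * S = Z ^+ 2 * (Z ^+ 3 * S)); last by ring.
  apply: ler_wpM2r; first by rewrite mulr_ge0 ?exprn_ge0 // ltW.
  by nra.
have N10 : 0 <= N1 ^+ 2 by rewrite exprn_ge0.
have := ler_wpM2r N10 h3.
have e1 : Z * S * (4 * Z ^+ 2 * N1 ^+ 2 + 2 * Z ^+ 2 * T) =
  4 * (Z ^+ 3 * S * N1 ^+ 2) + 2 * (Z ^+ 3 * S * T) by ring.
have e2 : 4 * Z ^+ 3 * S * T = 4 * (Z ^+ 3 * S * T) by ring.
rewrite e1 in h2; rewrite e2 => h4; lra.
Qed.

Lemma S_ge1 : 1 <= S.
Proof.
have : 0 < N by rewrite -SN exprn_gt0.
rewrite ltr0n -(ler1n R) -SN => h; rewrite leNgt; apply/negP => S1.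
by move: h; rewrite leNgt exprn_ilt1 // ltW.
Qed.

Let P := [seq p <- Pa | (S <= F p * Z ^+ 12) && (F p < Z ^+ 12 * S)].

Lemma sum_fibre : \sum_(p <- Pa) F p <= N1 * (Z ^+ 2 * n).
Proof.
rewrite exchange_big /=; apply: sum_le_const => b bB.
have b0 : b != 0 by apply/B0/(fsubsetP rich_mult_sub).
apply: le_trans card_diff.
rewrite sum_indicator ler_nat -size_filter -(size_map (fun p => p / b)).
apply: uniq_leq_size.
  by rewrite map_inj_uniq ?filter_uniq ?fset_uniq //; apply: mulIf; rewrite invr_eq0.
by move=> y /mapP[p]; rewrite mem_filter => /andP[/popdiffP[h _ _] _] ->.
Qed.

(** In the sum of $F^2$, large fibres are controlled by [fibre_tail] and small ones by the first
    moment [sum_fibre]. Each tail takes at most a quarter of the lower bound from [sum_fibre_sqr],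
    so fibres of size about $S$ supply at least half. *)
Lemma card_mid_fibres : n * S <= (size P)%:R * Z ^+ 38.
Proof.
have z100 := Z100; have z0 := Z0; have s0 := Sgt0; have np := n0.
have pw k : 0 < Z ^+ k by rewrite exprn_gt0.
have pw1 k : 1 <= Z ^+ k by rewrite exprn_ege1.
pose tau := Z ^+ 12 * S.
have tau0 : 0 < tau by rewrite mulr_gt0.
have tau4 : 4 <= tau.
  rewrite /tau exprS -mulrA; apply: le_trans (_ : Z * 1 <= _); first by lra.
  rewrite ler_pM2l // -[1]mulr1; apply: ler_pM => //; exact: S_ge1.
have Pa0 : {in Pa, forall p, p != 0}.
  move=> p /prodsetP[b [y [bB /popdiffP[_ y0 _] ->]]]; rewrite mulf_neq0 //.
  exact/B0/(fsubsetP rich_mult_sub).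
have DpD : Dp `<=` D by apply/fsubsetP => y /popdiffP[].
set hi := \sum_(p <- Pa | tau <= F p) F p ^+ 2.
set lo := \sum_(p <- Pa | F p < tau) F p ^+ 2.
have hi_le : Z ^+ 6 * S * hi <= 81 * (N1 ^+ 2 * n).
  have := fibre_tail A (fset_uniq rich_mult) (fset_uniq Pa) Pa0 DpD tau4.
  rewrite -/F -/hi => h.
  have h2 : #|` sumset A D|%:R ^+ 2 <= (Z ^+ 3 * n) ^+ 2.
    rewrite ler_pXn2r ?nnegrE ?ler0n //; first exact: card_sum_diff.
    by rewrite mulr_ge0 ?ler0n // ltW.
  have h3 : 0 <= 81 * N1 ^+ 2 by rewrite mulr_ge0 // exprn_ge0.
  have h4 := le_trans h (ler_wpM2l h3 h2).
  have nZ : 0 < Z ^+ 6 * n by rewrite mulr_gt0.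
  rewrite -(ler_pM2l nZ) (_ : _ * (81 * _) = 81 * N1 ^+ 2 * (Z ^+ 3 * n) ^+ 2);
    last by ring.
  apply: le_trans h4; rewrite le_eqVlt; apply/orP; left; apply/eqP.
  by rewrite /tau; ring.
have F0 p : 0 <= F p by apply: fibre_card_ge0.
have lo_le : Z ^+ 12 * lo <= S * (N1 * (Z ^+ 2 * n)) +
    Z ^+ 12 * ((size P)%:R * tau ^+ 2).
  apply: le_trans (_ : S * \sum_(p <- Pa) F p +
      Z ^+ 12 * ((size P)%:R * tau ^+ 2) <= _).
    rewrite -sum_const_seq /P big_filter [X in _ + _ * X]big_mkcond.
    rewrite !mulr_sumr -big_split /= [leLHS]big_mkcond.
    apply: ler_sum => p _; rewrite -/tau.
    case: (ltP (F p) tau) => Ft /=; last by rewrite andbF mulr0 addr0 mulr_ge0 // ltW.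
    rewrite andbT; case: (leP S (F p * Z ^+ 12)) => SF.
      apply: le_trans (_ : Z ^+ 12 * tau ^+ 2 <= _).
        by rewrite ler_pM2l // ler_pXn2r ?nnegrE ?F0 ?(ltW tau0) // ltW.
      by rewrite lerDr mulr_ge0 // ltW.
    rewrite mulr0 addr0 expr2 mulrA; apply: ler_wpM2r => //.
    by rewrite mulrC ltW.
  by rewrite lerD2r ler_pM2l // sum_fibre.
have main := sum_fibre_sqr; rewrite (sum_split_lt _ F _ tau) -/hi -/lo in main.
set sP := (size P)%:R in lo_le *.
have nS := card_rich_mult.
set a1 := N1 in hi_le lo_le main nS.
have a10 : 0 <= a1 by rewrite /a1.
have sP0 : 0 <= sP by rewrite /sP.
have hi2 : 4 * Z ^+ 3 * S * hi <= 1 / 4 * (n * a1 ^+ 2).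
  have na : 0 <= a1 ^+ 2 * n by rewrite mulr_ge0 ?exprn_ge0 // ltW.
  rewrite -(ler_pM2l (pw 3)).
  rewrite (_ : Z ^+ 3 * (4 * _ * _ * _) = 4 * (Z ^+ 6 * S * hi)); last by ring.
  (* $1296=4\cdot4\cdot81$: the constant of [hi_le], times 4, must fit into a quarter of $Z^3$. *)
  have Z3 : 1296 <= Z ^+ 3.
    apply: le_trans (_ : 100 ^+ 3 <= _); first by lra.
    by rewrite ler_pXn2r // nnegrE //; lra.
  have := ler_wpM2r na Z3; rewrite [n * _]mulrC; lra.
have lo2 : 4 * Z ^+ 3 * S * lo <=
    1 / 4 * (n * a1 ^+ 2) + 4 * Z ^+ 27 * S ^+ 3 * sP.
  rewrite -(ler_pM2l (pw 9)).
  rewrite (_ : Z ^+ 9 * (4 * _ * _ * _) = 4 * S * (Z ^+ 12 * lo)); last by ring.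
  have S4 : 0 <= 4 * S by lra.
  apply: (le_trans (ler_wpM2l S4 lo_le)).
  rewrite mulrDr mulrDr; apply: lerD; last first.
    by rewrite le_eqVlt; apply/orP; left; apply/eqP; rewrite /tau; ring.
  rewrite (_ : 4 * S * _ = S ^+ 2 * (4 * (a1 * (Z ^+ 2 * n)))); last by ring.
  have h1 : 0 <= 4 * (a1 * (Z ^+ 2 * n)) by rewrite !mulr_ge0 // ltW.
  apply: (le_trans (ler_wpM2r h1 nS)).
  rewrite (_ : a1 * _ * _ = 4 * (Z ^+ 7 * (n * a1 ^+ 2))); last by ring.
  rewrite (_ : Z ^+ 9 * _ = Z ^+ 2 / 4 * (Z ^+ 7 * (n * a1 ^+ 2))); last by field.
  apply: ler_wpM2r; first by rewrite !mulr_ge0 ?exprn_ge0 // ltW.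
  by rewrite expr2; nra.
have sum2 : n * a1 ^+ 2 <= 8 * Z ^+ 27 * S ^+ 3 * sP.
  rewrite mulrDr in main.
  have e : 8 * Z ^+ 27 * S ^+ 3 * sP = 4 * Z ^+ 27 * S ^+ 3 * sP +
      4 * Z ^+ 27 * S ^+ 3 * sP by ring.
  rewrite e; lra.
have S3 : 0 < S ^+ 3 by rewrite exprn_gt0.
have S2 : 0 <= S ^+ 2 by rewrite exprn_ge0 // ltW.
have sq : S ^+ 4 <= a1 ^+ 2 * Z ^+ 10.
  rewrite (_ : S ^+ 4 = S ^+ 2 ^+ 2); last by ring.
  rewrite (_ : a1 ^+ 2 * _ = (a1 * Z ^+ 5) ^+ 2); last by ring.
  by rewrite ler_pXn2r // nnegrE (le_trans S2 nS).
rewrite -(ler_pM2r S3).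
rewrite (_ : n * S * S ^+ 3 = n * S ^+ 4); last by ring.
apply: (le_trans (ler_wpM2l (ltW np) sq)); rewrite mulrA.
apply: (le_trans (ler_wpM2r (ltW (pw 10)) sum2)).
rewrite (_ : 8 * _ * _ * _ * _ = 8 * (Z ^+ 37 * (S ^+ 3 * sP))); last by ring.
rewrite (_ : sP * _ * _ = Z * (Z ^+ 37 * (S ^+ 3 * sP))); last by ring.
by apply: ler_wpM2r; [rewrite !mulr_ge0 ?exprn_ge0 // ltW | lra].
Qed.

Let G l p : R := \sum_(b <- rich_mult) ((p / b \in Dp) && (l * b \in B))%:R.

(** Every rich $b$ has at least $S^2/Z^{10}$ good ratios $l$ with $lb\in B$, so the sum of $G(l,p)$
    over $l$ is at least $S^2F(p)/Z^{10}$. As $G\le F$ and there are at most $Z^9S^2$ ratios, those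
    with $G<F/Z^{20}$ cannot account for it. *)
Lemma count_rich_ratios p : 0 < F p ->
  S ^+ 2 <= Z ^+ 11 * (count (fun l => F p <= G l p * Z ^+ 20) ratios)%:R.
Proof.
have z100 := Z100; have z0 := Z0; have s0 := Sgt0.
have pw k : 0 < Z ^+ k by rewrite exprn_gt0.
move=> Fp; set g := (count _ _)%:R.
have lower : S ^+ 2 * F p <= Z ^+ 10 * \sum_(l <- ratios) G l p.
  rewrite exchange_big /= !mulr_sumr; apply: ler_sum_in => b bB.
  have bB' := fsubsetP rich_mult_sub _ bB.
  case: (p / b \in Dp) => /=; last by rewrite mulr0 big1 ?mulr0.
  rewrite mulr1 mulrC; apply: (le_trans (deg_rich bB)).
  rewrite ler_pM2r // sum_indicator ler_nat /deg -!size_filter.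
  rewrite -(size_map (fun b' => b' / b)); apply: uniq_leq_size.
    rewrite map_inj_uniq ?filter_uniq ?fset_uniq //.
    by apply: mulIf; rewrite invr_eq0 B0.
  move=> l /mapP[b']; rewrite mem_filter => /andP[h b'B] ->.
  by rewrite mem_filter mem_ratios // divfK ?B0 // b'B.
have upper : Z ^+ 20 * \sum_(l <- ratios) G l p <=
    (size ratios)%:R * F p + Z ^+ 20 * (g * F p).
  rewrite /g -sum_indicator -sum_const_seq mulr_suml !mulr_sumr -big_split /=.
  apply: ler_sum => l _.
  have GF : G l p <= F p.
    by apply: ler_sum => b _; rewrite ler_nat; case: (p / b \in Dp) => //=; case: (_ \in _).
  case: (leP (F p) (G l p * Z ^+ 20)) => h /=.
    rewrite mul1r; apply: le_trans (_ : Z ^+ 20 * F p <= _).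
      by rewrite ler_pM2l.
    by rewrite lerDr ltW.
  by rewrite mul0r mulr0 addr0 mulrC ltW.
move: lower upper; set Y := \sum_(l <- ratios) G l p => lower upper.
have h1 : Z ^+ 10 * S ^+ 2 <= Z ^+ 9 * S ^+ 2 + Z ^+ 20 * g.
  rewrite -(ler_pM2r Fp).
  rewrite (_ : _ * F p = Z ^+ 10 * (S ^+ 2 * F p)); last by ring.
  rewrite (_ : (_ + _) * F p = Z ^+ 9 * S ^+ 2 * F p + Z ^+ 20 * (g * F p));
    last by ring.
  apply: (le_trans (ler_wpM2l (ltW (pw 10)) lower)).
  rewrite (_ : Z ^+ 10 * (Z ^+ 10 * Y) = Z ^+ 20 * Y); last by ring.
  apply: (le_trans upper); rewrite lerD2r.
  by apply: ler_wpM2r; [exact: ltW | exact: size_ratios].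
rewrite -(ler_pM2l (pw 9)).
rewrite (_ : Z ^+ 9 * (Z ^+ 11 * g) = Z ^+ 20 * g); last by ring.
have : 0 <= Z ^+ 9 * S ^+ 2 by rewrite mulr_ge0 ?exprn_ge0 // ltW.
rewrite (_ : Z ^+ 10 * S ^+ 2 = Z * (Z ^+ 9 * S ^+ 2)) in h1; last by ring.
move: h1; set X := Z ^+ 9 * S ^+ 2; set V := Z ^+ 20 * g => h1 X0.
have : 2 * X <= Z * X by apply: ler_wpM2r => //; lra.
lra.
Qed.

(** If $p=by$ with $y$ popular and $lb\in B$, then for at least $n/Z^7$ elements $a$ one has $a-y\in
    A$, and $l(ab-p)=(a-y)(lb)$ shows that $ab$ is the abscissa of a point of the line in $AB\times
    AB$. About $S$ such $b$ are available, and [elekes] bounds from below the number of distinct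
    abscissas. *)
Lemma rich_line_card l p : 4 <= Z ^- 7 * n -> l \in ratios ->
  F p <= G l p * Z ^+ 20 -> S <= F p * Z ^+ 12 ->
  S * n ^+ 2 <= Z ^+ 56 *
    line_card (prodset A B) (prodset A B) l (- l * p) ^+ 2.
Proof.
have z100 := Z100; have z0 := Z0; have np := n0.
have pw k : 0 < Z ^+ k by rewrite exprn_gt0.
move=> q4 lL FG SF; set k := line_card _ _ _ _.
have l0 := ratios_neq0 lL.
pose Gs := [seq b <- rich_mult | (p / b \in Dp) && (l * b \in B)].
pose U := [fset u in prodset A B | l * u + - l * p \in prodset A B].
have kU : k = #|` U|%:R.
  rewrite /k /line_card sum_indicator -size_filter; congr (_%:R); apply: perm_size.
  apply: uniq_perm; rewrite ?filter_uniq ?fset_uniq // => u.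
  by rewrite mem_filter !inE andbC.
have GsB b : b \in Gs -> b \in B.
  by rewrite mem_filter => /andP[_]; apply: (fsubsetP rich_mult_sub).
have h : (size Gs)%:R * n * (Z ^- 7 * n) ^+ 3 <=
    81 * #|` sumset A A|%:R ^+ 2 * #|` U|%:R ^+ 2.
  apply: elekes q4 _; first by rewrite filter_uniq ?fset_uniq.
    by move=> b /GsB /B0.
  move=> b bG; have bB := GsB _ bG; have b0 := B0 bB.
  move: bG; rewrite mem_filter => /andP[/andP[/popdiffP[_ _ pop] lb] _].
  apply: (le_trans pop); apply: ler_sum_in => a aA.
  rewrite ler_nat; case h: (_ \in A) => //.
  rewrite (_ : b * a \in U) // !inE /= [b * a]mulrC mem_prodset //=.
  have -> : l * (a * b) + - l * p = (a - p / b) * (l * b) by field.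
  exact: mem_prodset.
have sG : S <= (size Gs)%:R * Z ^+ 32.
  rewrite /Gs size_filter -sum_indicator -/(G l p).
  apply: (le_trans SF); rewrite (_ : G l p * _ = G l p * Z ^+ 20 * Z ^+ 12).
    by rewrite ler_pM2r.
  by ring.
have n3 : 0 < n ^+ 3 by rewrite exprn_gt0.
have n2 : 0 < n ^+ 2 by rewrite exprn_gt0.
have h2 : #|` sumset A A|%:R ^+ 2 <= (Z * n) ^+ 2.
  by rewrite ler_pXn2r // nnegrE ?ler0n // mulr_ge0 // ltW.
have U0 : 0 <= #|` U|%:R ^+ 2 :> R by rewrite exprn_ge0.
have h3 : (size Gs)%:R * n * (Z ^- 7 * n) ^+ 3 <= 81 * (Z * n) ^+ 2 * #|` U|%:R ^+ 2.
  by apply: (le_trans h); apply: ler_wpM2r => //; rewrite ler_pM2l.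
rewrite kU -(ler_pM2r n2).
apply: le_trans (_ : (size Gs)%:R * Z ^+ 32 * n ^+ 2 * n ^+ 2 <= _).
  by rewrite !ler_pM2r.
have -> : (size Gs)%:R * Z ^+ 32 * n ^+ 2 * n ^+ 2 =
    Z ^+ 53 * ((size Gs)%:R * n * (Z ^- 7 * n) ^+ 3).
  by field; rewrite gt_eqF.
apply: (le_trans (ler_wpM2l (ltW (pw 53)) h3)).
set u := #|` U|%:R ^+ 2.
have -> : Z ^+ 53 * (81 * (Z * n) ^+ 2 * u) = 81 * (Z ^+ 55 * (n ^+ 2 * u)) by ring.
have -> : Z ^+ 56 * u * n ^+ 2 = Z * (Z ^+ 55 * (n ^+ 2 * u)) by ring.
by apply: ler_wpM2r; [rewrite !mulr_ge0 // ltW | lra].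
Qed.

(** There are at least $nS^3/Z^{49}$ lines $u\mapsto l(u-p)$ with at least $nW/Z^{28}$ points in
    $AB\times AB$. Since [rich_lines] allows at most $81|AB|^4/t^3$ lines of richness $t$, it
    follows that $W\le81Z^{137}$. *)
Lemma large_set (W : R) : 0 < W -> W ^+ 2 = S -> W <= Z ^+ 138.
Proof.
have z100 := Z100; have z0 := Z0; have np := n0; have s0 := Sgt0.
have pw k : 0 < Z ^+ k by rewrite exprn_gt0.
(* Arguing by contradiction makes $W$ large, which supplies the thresholds of at least 4 demanded by
   [elekes] and [rich_lines]. *)
move=> W0 WS; rewrite leNgt; apply/negP => big.
have bigW k : (k < 138)%N -> 100 * Z ^+ k <= W.
  move=> k138; apply: ltW; apply: le_lt_trans big.
  apply: le_trans (_ : Z ^+ k.+1 <= _); first by rewrite exprS ler_pM2r.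
  by apply: ler_weXn2l => //; exact: Z1.
have W1 : 1 <= W by have := bigW 0%N isT; rewrite expr0; lra.
have nW : W <= n.
  apply: le_trans large; rewrite -WS expr2 -{1}[W]mul1r mulrA.
  rewrite ler_pM2r // -[1]mulr1; apply: ler_pM => //.
  by rewrite exprn_ege1 //; exact: Z1.
have q4 : 4 <= Z ^- 7 * n.
  rewrite mulrC ler_pdivlMr //; apply: le_trans nW.
  by apply: le_trans (bigW 7 isT); rewrite ler_pM2r //; lra.
pose t := n * W / Z ^+ 28.
have t4 : 4 <= t.
  rewrite ler_pdivlMr //; apply: le_trans (_ : W <= _).
    by apply: le_trans (bigW 28 isT); rewrite ler_pM2r //; lra.
  by rewrite -{1}[W]mul1r ler_pM2r // (le_trans W1).
have t0 : 0 < t by lra.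
pose s := [seq lp <- [seq (l, p) | p <- P, l <- ratios] |
             F lp.2 <= G lp.1 lp.2 * Z ^+ 20].
have sP p : p \in P -> S <= F p * Z ^+ 12 /\ 0 < F p.
  rewrite mem_filter => /andP[/andP[h _] _]; split=> //.
  by rewrite -(pmulr_lgt0 _ (pw 12)); apply: lt_le_trans h.
have size_s : (size P)%:R * S ^+ 2 <= Z ^+ 11 * (size s)%:R.
  rewrite /s size_filter -sum_indicator big_allpairs_dep /= mulr_sumr.
  apply: sum_ge_const => p /sP[_ Fp]; rewrite sum_indicator.
  exact: count_rich_ratios.
pose k (lp : R * R) := line_card (prodset A B) (prodset A B) lp.1 (- lp.1 * lp.2).
have inS lp : lp \in s -> [/\ lp.1 \in ratios, lp.2 \in P &
    F lp.2 <= G lp.1 lp.2 * Z ^+ 20].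
  by rewrite mem_filter => /andP[h /allpairsP[[p l] /= [pP lL e]]]; rewrite e in h *.
have rich : {in s, forall lp, t <= k lp}.
  move=> lp /inS[lL pP FG]; have [SF _] := sP _ pP.
  have := rich_line_card q4 lL FG SF; rewrite -/(k lp) -WS => h.
  rewrite ler_pdivrMr //.
  have k0 : 0 <= k lp by apply: line_card_ge0.
  have kZ0 : 0 <= k lp * Z ^+ 28 by apply: mulr_ge0 => //; apply: ltW.
  have nW0 : 0 <= n * W by apply: mulr_ge0; apply: ltW.
  rewrite -(@ler_pXn2r _ 2) // ?nnegrE //.
  rewrite (_ : (n * W) ^+ 2 = W ^+ 2 * n ^+ 2); last by ring.
  by apply: (le_trans h); rewrite le_eqVlt; apply/orP; left; apply/eqP; ring.
have us : uniq s.
  rewrite filter_uniq //; apply: allpairs_uniq; rewrite ?ratios_uniq //.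
    by rewrite filter_uniq ?fset_uniq.
  by move=> [a b] [c d] _ _ [-> ->].
have h : t * \sum_(lp <- s | t <= k lp) k lp ^+ 2 <=
    81 * #|` prodset A B|%:R ^+ 2 * #|` prodset A B|%:R ^+ 2.
  apply: (rich_lines (fset_uniq _) (fset_uniq _) us) t4.
    by move=> lp /inS[/ratios_neq0].
  move=> [l p] [l' p'] /inS[/= lL _ _] _ /= <-.
  by rewrite !mulNr => /oppr_inj /(mulfI (ratios_neq0 lL)) ->.
have h1 : (size s)%:R * t ^+ 3 <= 81 * (Z * S * n) ^+ 4.
  apply: le_trans (_ : t * \sum_(lp <- s | t <= k lp) k lp ^+ 2 <= _).
    rewrite exprS mulrCA ler_pM2l // -sum_const_seq big_seq [leRHS]big_seq_cond.
    under [leRHS]eq_bigl => lp.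
      rewrite (_ : _ && _ = (lp \in s)); last first.
        by case ps: (lp \in s) => //=; rewrite rich.
      over.
    apply: ler_sum => lp ps; rewrite ler_pXn2r ?nnegrE ?(ltW t0) ?line_card_ge0 //.
    exact: rich.
  apply: (le_trans h); rewrite -mulrA -exprD ler_pM2l //.
  by rewrite ler_pXn2r // nnegrE ?ler0n // !mulr_ge0 // ltW.
have h2 : (size s)%:R * (n ^+ 3 * W ^+ 3) <= 81 * Z ^+ 88 * (S ^+ 4 * n ^+ 4).
  have -> : (size s)%:R * (n ^+ 3 * W ^+ 3) = Z ^+ 84 * ((size s)%:R * t ^+ 3).
    by rewrite /t; field; rewrite gt_eqF.
  apply: (le_trans (ler_wpM2l (ltW (pw 84)) h1)).
  by rewrite le_eqVlt; apply/orP; left; apply/eqP; ring.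
have nW3 : 0 < n ^+ 3 * W ^+ 3 by rewrite mulr_gt0 ?exprn_gt0.
have h3 : (size P)%:R * S ^+ 2 * (n ^+ 3 * W ^+ 3) <=
    81 * Z ^+ 99 * (S ^+ 4 * n ^+ 4).
  apply: (le_trans (ler_wpM2r (ltW nW3) size_s)).
  rewrite (_ : Z ^+ 11 * _ * (n ^+ 3 * W ^+ 3) =
    Z ^+ 11 * ((size s)%:R * (n ^+ 3 * W ^+ 3))); last by ring.
  apply: (le_trans (ler_wpM2l (ltW (pw 11)) h2)).
  by rewrite le_eqVlt; apply/orP; left; apply/eqP; ring.
have S2 : 0 < S ^+ 2 * (n ^+ 3 * W ^+ 3) by rewrite mulr_gt0 // exprn_gt0.
have h4 : n * S * (S ^+ 2 * (n ^+ 3 * W ^+ 3)) <=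
    81 * Z ^+ 137 * (S ^+ 4 * n ^+ 4).
  apply: (le_trans (ler_wpM2r (ltW S2) card_mid_fibres)).
  rewrite (_ : (size P)%:R * Z ^+ 38 * _ = Z ^+ 38 * ((size P)%:R * S ^+ 2 * (n ^+ 3 * W ^+ 3)));
    last by ring.
  apply: (le_trans (ler_wpM2l (ltW (pw 38)) h3)).
  by rewrite le_eqVlt; apply/orP; left; apply/eqP; ring.
have c0 : 0 < S ^+ 3 * n ^+ 4 * W ^+ 2 by rewrite !mulr_gt0 ?exprn_gt0.
have : W <= 81 * Z ^+ 137.
  rewrite -(ler_pM2r c0).
  rewrite (_ : W * _ = n * S * (S ^+ 2 * (n ^+ 3 * W ^+ 3))); last by ring.
  apply: (le_trans h4); rewrite -WS.
  by rewrite le_eqVlt; apply/orP; left; apply/eqP; ring.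
have := bigW 137 isT; have := pw 137%N; set X := Z ^+ 137 => X0 a b; lra.
Qed.

End LargeSet.

(** * Removing the triple-sum hypothesis, and multiplicative Plünnecke *)

Section Reductions.
Variable R : realType.
Implicit Types (A B : {fset R}) (Z S : R).

Lemma card_sumset_ge A B : A != fset0 -> (#|` B| <= #|` sumset A B|)%N.
Proof.
move=> /fset0Pn[a aA]; rewrite -(size_map (fun b => a + b)).
apply: uniq_leq_size; first by rewrite map_inj_uniq ?fset_uniq //; apply: addrI.
by move=> x /mapP[b bB ->]; apply: mem_sumset.
Qed.

(** Petridis's lemma gives $X\subseteq A$ with $|X+A+A|\le Z^2|X|$ and $|X|\ge|A|/Z$, so [large_set]
    applies to $X$ with $Z^2$ in place of $Z$. As $|B|=W^4$, the exponent is
    $4\cdot2\cdot138=1104$. *)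
Lemma large_set_doubling A B Z S : 100 <= Z -> 0 < S -> S ^+ 2 = #|` B|%:R ->
  0 \notin A -> {in B, forall b, 0 < b} ->
  #|` sumset A A|%:R <= Z * #|` A|%:R ->
  #|` prodset A B|%:R <= Z * S * #|` A|%:R ->
  Z ^+ 11 * S <= #|` A|%:R ->
  #|` B|%:R <= Z ^+ 1104.
Proof.
move=> Z100 S0 SN A0 Bpos dbl prd large.
have Z0 : 0 < Z by lra.
have pw k : 0 < Z ^+ k by rewrite exprn_gt0.
have n0 : 0 < #|` A|%:R :> R by apply: lt_le_trans large; rewrite mulr_gt0.
have An0 : A != fset0 by rewrite -cardfs_gt0 -(ltr0n R).
have [X [XA X0 h1 h2]] := petridis A An0.
have x0 : 0 < #|` X|%:R :> R by rewrite ltr0n cardfs_gt0.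
have XA1 : #|` sumset X A|%:R <= Z * #|` X|%:R.
  rewrite -(ler_pM2r n0) -natrM.
  apply: le_trans (_ : #|` sumset A A|%:R * #|` X|%:R <= _).
    by rewrite -natrM ler_nat.
  by rewrite mulrAC ler_pM2r.
have XA2 : #|` sumset (sumset X A) A|%:R <= Z ^+ 2 * #|` X|%:R.
  rewrite -(ler_pM2r x0) -natrM.
  apply: le_trans (_ : #|` sumset X A|%:R * #|` sumset X A|%:R <= _).
    by rewrite -natrM ler_nat h2.
  rewrite (_ : Z ^+ 2 * #|` X|%:R * #|` X|%:R = (Z * #|` X|%:R) * (Z * #|` X|%:R)); last by ring.
  by apply: ler_pM; rewrite ?ler0n.
have nX : #|` A|%:R <= Z * #|` X|%:R.
  by apply: le_trans XA1; rewrite ler_nat card_sumset_ge.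
have Z2 : Z <= Z ^+ 2 by rewrite expr2; nra.
have Z22 : Z ^+ 2 <= Z ^+ 2 ^+ 2 by rewrite [leRHS]expr2; nra.
pose W : R := Num.sqrt S.
have W0 : 0 < W by rewrite sqrtr_gt0.
have WS : W ^+ 2 = S by rewrite sqr_sqrtr // ltW.
have := @large_set R X B (Z ^+ 2) S _ S0 SN _ Bpos _ _ _ _ W W0 WS.
have XX : sumset X X `<=` sumset X A by apply: sumsetS.
move=> h.
have {}h : W <= Z ^+ 2 ^+ 138.
  apply: h.
  - lra.
  - by apply: contra A0 => /(fsubsetP XA).
  - apply: le_trans (_ : Z * #|` X|%:R <= _); last by rewrite ler_pM2r.
    by apply: le_trans XA1; rewrite ler_nat fsubset_leq_card.
  - apply: le_trans (_ : Z ^+ 2 * #|` X|%:R <= _); last by rewrite ler_pM2r.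
    by apply: le_trans XA2; rewrite ler_nat fsubset_leq_card // sumsetS.
  - apply: le_trans (_ : #|` prodset A B|%:R <= _).
      by rewrite ler_nat fsubset_leq_card // prodsetS.
    apply: (le_trans prd); rewrite (_ : Z ^+ 2 * S * _ = Z * S * (Z * #|` X|%:R));
      last by ring.
    by rewrite ler_pM2l // mulr_gt0.
  - rewrite -(ler_pM2l Z0); apply: le_trans nX; apply: le_trans large.
    by rewrite le_eqVlt; apply/orP; left; apply/eqP; ring.
rewrite -SN -WS -exprM.
apply: le_trans (_ : (Z ^+ 2 ^+ 138) ^+ (2 * 2) <= _); last by rewrite -!exprM.
by rewrite ler_pXn2r // nnegrE ?ltW // exprn_gt0.
Qed.

Definition quotset A B : {fset R} := [fset a / b | a in A, b in B].

Lemma quotsetP A B x :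
  reflect (exists a b, [/\ a \in A, b \in B & x = a / b]) (x \in quotset A B).
Proof.
apply: (iffP (imfset2P _ _ _ _ _)) => [[a /= aA [b bB ->]]|[a [b [aA bB ->]]]].
  by exists a, b.
by exists a => //; exists b.
Qed.

Lemma mem_quotset A B a b : a \in A -> b \in B -> a / b \in quotset A B.
Proof. by move=> aA bB; apply/quotsetP; exists a, b. Qed.

                                                                           
(** Logarithms turn products into sums. Petridis's lemma yields $X\subseteq\ln B$ with $|X+\ln A+\ln
    A|\le c^2|X|$, and Ruzsa's inequality through $X$ bounds the differences of $\ln A+\ln A$. *)
Lemma card_quot_prod A B (c : R) : {in A, forall a, 0 < a} ->
  {in B, forall b, 0 < b} -> B != fset0 -> 0 <= c ->
  #|` prodset A B|%:R <= c * #|` B|%:R ->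
  #|` quotset (prodset A A) (prodset A A)|%:R <= c ^+ 4 * #|` B|%:R.
Proof.
move=> Apos Bpos B0 c0 hc.
pose LA := [fset ln a | a in A]; pose LB := [fset ln b | b in B].
have lnP (C : {fset R}) x :
    reflect (exists2 a, a \in C & x = ln a) (x \in [fset ln a | a in C]).
  exact: (iffP (imfsetP _ _ _ _)).
have LBc : #|` LB| = #|` B|.
  by apply: card_in_imfset => x y xB yB /=; apply: ln_inj; rewrite posrE Bpos.
have LB0 : LB != fset0 by rewrite -cardfs_gt0 LBc cardfs_gt0.
have [X [XB X0 h1 h2]] := petridis LA LB0.
have x0 : 0 < #|` X|%:R :> R by rewrite ltr0n cardfs_gt0.
have b0 : 0 < #|` B|%:R :> R by rewrite ltr0n cardfs_gt0.
have LL : (#|` sumset LB LA| <= #|` prodset A B|)%N.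
  apply: leq_trans (_ : #|` [fset ln x | x in prodset A B]| <= _)%N.
    apply/fsubset_leq_card/fsubsetP => x /sumsetP[_ [_ [/lnP[b bB ->] /lnP[a aA ->] ->]]].
    apply/lnP; exists (a * b); first exact: mem_prodset.
    by rewrite lnM ?posrE; [rewrite addrC | exact: Apos | exact: Bpos].
  exact: leq_imfset_card.
have X1 : #|` sumset X LA|%:R <= c * #|` X|%:R.
  rewrite -(ler_pM2r b0) -natrM.
  apply: le_trans (_ : #|` prodset A B|%:R * #|` X|%:R <= _).
    rewrite -natrM ler_nat -LBc; apply: (leq_trans h1).
    by rewrite leq_mul2r LL orbT.
  by rewrite mulrAC ler_pM2r.
have X2 : #|` sumset (sumset X LA) LA|%:R <= c ^+ 2 * #|` X|%:R.
  rewrite -(ler_pM2r x0) -natrM.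
  apply: le_trans (_ : #|` sumset X LA|%:R * #|` sumset X LA|%:R <= _).
    by rewrite -natrM ler_nat h2.
  rewrite (_ : c ^+ 2 * #|` X|%:R * #|` X|%:R = (c * #|` X|%:R) * (c * #|` X|%:R)); last by ring.
  by apply: ler_pM; rewrite ?ler0n.
pose L2 := sumset LA LA.
have L2X : sumset L2 X `<=` sumset (sumset X LA) LA.
  apply/fsubsetP => y /sumsetP[_ [x [/sumsetP[a [b [aA bA ->]] xX ->]]]].
  by rewrite addrC addrA; apply: mem_sumset => //; apply: mem_sumset.
have D2 : #|` diffset L2 L2|%:R <= c ^+ 4 * #|` X|%:R.
  rewrite -(ler_pM2r x0) -natrM.
  apply: le_trans (_ : #|` sumset L2 X|%:R * #|` sumset L2 X|%:R <= _).
    by rewrite -natrM ler_nat ruzsa.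
  rewrite (_ : c ^+ 4 * #|` X|%:R * #|` X|%:R = (c ^+ 2 * #|` X|%:R) * (c ^+ 2 * #|` X|%:R));
    last by ring.
  have X3 : #|` sumset L2 X|%:R <= c ^+ 2 * #|` X|%:R.
    by apply: le_trans X2; rewrite ler_nat fsubset_leq_card.
  by apply: ler_pM; rewrite ?ler0n.
have AApos x : x \in prodset A A -> 0 < x.
  by move=> /prodsetP[a [b [aA bA ->]]]; rewrite mulr_gt0 ?Apos.
have lnAA x : x \in prodset A A -> ln x \in L2.
  move=> /prodsetP[a [b [aA bA ->]]]; rewrite lnM ?posrE ?Apos //.
  by apply: mem_sumset; apply/lnP; [exists a | exists b].
apply: le_trans (_ : #|` diffset L2 L2|%:R <= _).
  rewrite ler_nat -(size_map (@ln R)); apply: uniq_leq_size.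
    rewrite map_inj_in_uniq ?fset_uniq // => x y.
    move=> /quotsetP[u [v [uA vA ->]]] /quotsetP[u' [v' [u'A v'A ->]]].
    by apply: ln_inj; rewrite posrE divr_gt0 ?AApos.
  move=> y /mapP[_ /quotsetP[u [v [uA vA ->]]] ->].
  by rewrite ln_div ?posrE ?AApos // mem_diffset ?lnAA.
apply: (le_trans D2); rewrite ler_wpM2l ?exprn_ge0 // ler_nat -LBc.
exact: fsubset_leq_card.
Qed.

End Reductions.

                                     

(** * The case of |B| comparable to the square of |A| *)

Section SmallSet.
Variables (R : realType) (A : {fset R}) (Z : R).
Local Notation n := (#|` A|%:R : R).
Let AA := prodset A A.
Let G2 := quotset AA AA.
Let QA := quotset A A.
Hypotheses (Z100 : 100 <= Z) (Apos : {in A, forall a, 0 < a}) (n0 : 0 < n).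
Hypotheses (dbl : #|` sumset A A|%:R <= Z * n)
  (trp : #|` G2|%:R <= Z ^+ 50 * n ^+ 2).

Let Z0 : 0 < Z. Proof. by move: Z100; lra. Qed.
Let Z1 : 1 <= Z. Proof. by move: Z100; lra. Qed.
Let pw k : 0 < Z ^+ k. Proof. by rewrite exprn_gt0. Qed.
Let A0 : {in A, forall a, a != 0}.
Proof. by move=> a /Apos; rewrite lt_def => /andP[]. Qed.
Let zA : 0 \notin A. Proof. by apply/negP => /A0; rewrite eqxx. Qed.
Let rA := ratio_card A.

Let QA_gt0 l : l \in QA -> 0 < l.
Proof. by move=> /quotsetP[a [b [aA bA ->]]]; rewrite divr_gt0 ?Apos. Qed.

Let G2_gt0 l : l \in G2 -> 0 < l.
Proof.
have AAp x : x \in AA -> 0 < x.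
  by move=> /prodsetP[a [b [aA bA ->]]]; rewrite mulr_gt0 ?Apos.
by move=> /quotsetP[a [b [aA bA ->]]]; rewrite divr_gt0 ?AAp.
Qed.

Let neq0 (l : R) : 0 < l -> l != 0. Proof. by rewrite lt_def => /andP[]. Qed.

Lemma sum_ratio_eq (mu : R) :
  \sum_(a <- A) \sum_(b <- A) (a / b == mu)%:R = rA mu.
Proof.
rewrite exchange_big /=; apply: eq_big_seq => b bA.
rewrite -(sum_eq_indicator _ _ (fset_uniq A)); apply: eq_bigr => a _.
congr ((nat_of_bool _)%:R); have b0 := A0 bA.
by apply/eqP/eqP => [<-|<-]; [rewrite divfK | rewrite mulfK].
Qed.

(** If $q^2$ ratios have at least $Z^7$ representations each, [sum_ratio_card] gives $q^2Z^7\le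
    Z^3nq$; hence $q\le n/Z^4$, and these ratios cover at most $n^2/Z$ pairs. *)
Lemma sum_big_ratio :
  Z * \sum_(l <- [seq l <- QA | Z ^+ 7 <= rA l]) rA l <= n ^+ 2.
Proof.
have z100 := Z100; have z0 := Z0.
set La := [seq l <- _ | _]; set q : R := Num.sqrt (size La)%:R.
have q0 : 0 <= q by apply: sqrtr_ge0.
have qq : q ^+ 2 = (size La)%:R by rewrite sqr_sqrtr ?ler0n.
have h1 : \sum_(l <- La) rA l <= Z ^+ 3 * (n * q).
  apply: le_trans (sum_ratio_card _ _ zA Z1 dbl) _.
  - by rewrite filter_uniq ?fset_uniq.
  - by move=> l; rewrite mem_filter => /andP[_ /QA_gt0 /neq0].
  rewrite -/q (_ : 18 * _ * _ * _ = 18 * Z ^+ 2 * (n * q)); last by ring.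
  apply: ler_wpM2r; first by rewrite mulr_ge0 // ltW.
  rewrite [Z ^+ 3]exprS; apply: ler_wpM2r; first exact: ltW.
  by lra.
have h2 : q ^+ 2 * Z ^+ 7 <= Z ^+ 3 * (n * q).
  apply: le_trans h1; rewrite qq; apply: sum_ge_const => l.
  by rewrite mem_filter => /andP[].
have h3 : q * Z ^+ 4 <= n.
  have [->|qn0] := eqVneq q 0; first by rewrite mul0r ltW.
  have qp : 0 < q by rewrite lt_def qn0.
  have c0 : 0 < q * Z ^+ 3 by rewrite mulr_gt0.
  rewrite -(ler_pM2l c0); apply: le_trans (_ : q ^+ 2 * Z ^+ 7 <= _).
    by rewrite le_eqVlt; apply/orP; left; apply/eqP; ring.
  by apply: (le_trans h2); rewrite le_eqVlt; apply/orP; left; apply/eqP; ring.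
apply: le_trans (ler_wpM2l (ltW z0) h1) _.
rewrite (_ : Z * _ = n * (q * Z ^+ 4)); last by ring.
by rewrite expr2 ler_pM2l.
Qed.

Let good (l : R) : bool := rA l < Z ^+ 7.

Lemma good_pairs : n ^+ 2 <=
  \sum_(a <- A) \sum_(b <- A) (good (a / b))%:R + n ^+ 2 / Z.
Proof.
have z0 := Z0.
have e : n ^+ 2 = \sum_(a <- A) \sum_(b <- A) 1 :> R.
  by under eq_bigr => b _ do rewrite sum_const_seq; rewrite sum_const_seq; ring.
set La := [seq l <- QA | Z ^+ 7 <= rA l].
rewrite {1}e.
apply: le_trans (_ : \sum_(a <- A) \sum_(b <- A) (good (a / b))%:R +
  \sum_(l <- La) rA l <= _); last first.
  by rewrite lerD2l ler_pdivlMr // mulrC sum_big_ratio.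
have -> : \sum_(l <- La) rA l = \sum_(a <- A) \sum_(b <- A) (a / b \in La)%:R.
  under eq_bigr => l _ do rewrite -sum_ratio_eq.
  rewrite exchange_big /=; apply: eq_bigr => a _.
  rewrite exchange_big /=; apply: eq_bigr => b _.
  by rewrite sum_eq_indicator ?filter_uniq ?fset_uniq.
rewrite -big_split /=; apply: ler_sum_in => a aA.
rewrite -big_split /=; apply: ler_sum_in => b bA.
rewrite mem_filter mem_quotset // andbT /good.
by case: leP => _ /=; rewrite ?addr0 ?add0r.
Qed.

Lemma half_good_pairs : n ^+ 2 <=
  100 / 99 * \sum_(a <- A) \sum_(b <- A) (good (a / b))%:R.
Proof.
have := good_pairs; set g := \sum_(a <- A) _; have z0 := Z0; have z100 := Z100.
have : n ^+ 2 / Z <= 1 / 100 * n ^+ 2.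
  rewrite mulrC; apply: ler_wpM2r; first by rewrite exprn_ge0 // ltW.
  by rewrite -(ler_pM2r z0) mulVf ?gt_eqF //; lra.
lra.
Qed.

(** Almost all pairs have a good quotient, and a good quotient has fewer than $Z^7$
    representations. *)
Lemma card_quotset_self : n ^+ 2 <= Z ^+ 8 * #|` QA|%:R.
Proof.
have z100 := Z100; have z0 := Z0.
apply: (le_trans half_good_pairs).
have h : \sum_(a <- A) \sum_(b <- A) (good (a / b))%:R <= #|` QA|%:R * Z ^+ 7.
  have -> : \sum_(a <- A) \sum_(b <- A) (good (a / b))%:R =
      \sum_(l <- QA) (good l)%:R * rA l.
    under [RHS]eq_bigr => l _.
      rewrite -sum_ratio_eq mulr_sumr; under eq_bigr => a _ do rewrite mulr_sumr.
      over.
    rewrite [RHS]exchange_big /=; apply: eq_big_seq => a aA.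
    rewrite [RHS]exchange_big /=; apply: eq_big_seq => b bA.
    under [RHS]eq_bigr => l _ do rewrite mulrC.
    by rewrite (sum_eq_mul (fun l => (good l)%:R)) ?fset_uniq ?mem_quotset.
  apply: sum_le_const => l _; rewrite /good.
  by case: ltP => h; rewrite ?mul1r ?mul0r ltW.
have c0 : 0 <= Z ^+ 7 * #|` QA|%:R by rewrite mulr_ge0 ?ler0n // ltW.
rewrite (_ : Z ^+ 8 * _ = Z * (Z ^+ 7 * #|` QA|%:R)); last by ring.
have := ler_wpM2r c0 z100; rewrite mulrC in h; move: h c0.
set X := Z ^+ 7 * _; set Y := \sum_(a <- A) _ => h c0 h'; lra.
Qed.

Let quads (l : R) : R := \sum_(a <- A) \sum_(a' <- A) \sum_(b <- A) \sum_(b' <- A)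
  (a * b' / (a' * b) == l)%:R * (good (b / b'))%:R.
(** If $a/(la')=b/b'$, then $a-la'=(a/b)(b-b')$: these are the pairs whose difference has
    multiplicative structure. *)
Let ypairs (l : R) : R := \sum_(a <- A) \sum_(a' <- A) (a / (l * a') \in QA)%:R.

Lemma sum_quads : \sum_(l <- G2) quads l =
  n ^+ 2 * \sum_(a <- A) \sum_(b <- A) (good (a / b))%:R.
Proof.
rewrite expr2 -mulrA -sum_const_seq exchange_big /=; apply: eq_big_seq => a aA.
rewrite -sum_const_seq exchange_big /=; apply: eq_big_seq => a' a'A.
rewrite exchange_big /=; apply: eq_big_seq => b bA.
rewrite exchange_big /=; apply: eq_big_seq => b' b'A.
rewrite -mulr_suml sum_eq_indicator ?fset_uniq //.
by rewrite mem_quotset ?mul1r // mem_prodset.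
Qed.

(** Given $a$ and $a'$, the quotient $b/b'$ must equal $a/(la')$; it lies in $A/A$ and, being good,
    has fewer than $Z^7$ representations. *)
Lemma quads_le l : 0 < l -> quads l <= Z ^+ 7 * ypairs l.
Proof.
move=> l0; rewrite /quads /ypairs mulr_sumr; apply: ler_sum_in => a aA.
rewrite mulr_sumr; apply: ler_sum_in => a' a'A.
set mu := a / (l * a').
have ln0 := neq0 l0; have an0 := A0 aA; have a'n0 := A0 a'A.
have -> : \sum_(b <- A) \sum_(b' <- A)
    (a * b' / (a' * b) == l)%:R * (good (b / b'))%:R =
    (good mu)%:R * \sum_(b <- A) \sum_(b' <- A) (b / b' == mu)%:R :> R.
  rewrite mulr_sumr; apply: eq_big_seq => b bA.
  rewrite mulr_sumr; apply: eq_big_seq => b' b'A.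
  have bn0 := A0 bA; have b'n0 := A0 b'A.
  have -> : (a * b' / (a' * b) == l) = (b / b' == mu).
    apply/eqP/eqP => e; first by rewrite /mu -e; field; rewrite an0 bn0 a'n0 b'n0.
    have {}e : b = mu * b' by rewrite -e divfK.
    by rewrite e /mu; field; rewrite ln0 an0 a'n0 b'n0.
  by case: eqP => [->|_]; rewrite ?mul0r ?mulr0 // mulrC.
case: (boolP (mu \in QA)) => muQ; last first.
  rewrite mulr0 big_seq big1 ?mulr0 // => b bA.
  rewrite big_seq big1 // => b' b'A.
  by case: eqP => // e; rewrite -e mem_quotset in muQ.
rewrite mulr1 sum_ratio_eq /good.
by case: ltP => h; rewrite ?mul1r ?mul0r ltW.
Qed.

Lemma ypairs_le l : ypairs l <= n ^+ 2.
Proof.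
rewrite expr2; apply: sum_le_const => a _; rewrite -[leRHS]mulr1.
by apply: sum_le_const => a' _; case: (_ \in _); rewrite ?lexx ?ler01.
Qed.

Lemma sum_energy_G2 : \sum_(l <- G2) energy A l <= Z ^+ 51 * n ^+ 4.
Proof.
have z100 := Z100.
have := @sum_energy R A G2 4 (fset_uniq _) (fun l lG => neq0 (G2_gt0 lG)) (lexx _).
set E := \sum_(l <- _) _ => h.
have h2 : 4 ^+ 2 * #|` G2|%:R * n ^+ 2 <= 16 * (Z ^+ 50 * n ^+ 4).
  rewrite (_ : 16 * _ = 4 ^+ 2 * (Z ^+ 50 * n ^+ 2) * n ^+ 2); last by ring.
  rewrite ler_pM2r ?exprn_gt0 //; apply: ler_wpM2l trp; lra.
have h3 : n ^+ 4 <= Z ^+ 50 * n ^+ 4.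
  by rewrite -{1}[n ^+ 4]mul1r ler_pM2r ?exprn_gt0 // exprn_ege1.
have h4 : 0 < Z ^+ 50 * n ^+ 4 by rewrite mulr_gt0 // exprn_gt0.
have h5 := ler_wpM2r (ltW h4) z100.
rewrite (_ : Z ^+ 51 * _ = Z * (Z ^+ 50 * n ^+ 4)); last by ring.
move: h2 h3 h4 h5 h; set X := Z ^+ 50 * n ^+ 4; set Y := n ^+ 4; move=> *; lra.
Qed.

(** Averaging over $AA/AA$: the [quads] add up to at least $\frac{99}{100}n^4$ and the energies to
    at most $Z^{51}n^4$, over at most $Z^{50}n^2$ values of $l$. *)
Lemma good_ratio_exists : exists2 l, 0 < l &
  l \in G2 /\ (energy A l <= Z ^+ 59 * n ^+ 2 /\ n ^+ 2 <= Z ^+ 58 * ypairs l).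
Proof.
have z100 := Z100; have z0 := Z0.
pose P l := (energy A l <= Z ^+ 59 * n ^+ 2) && (n ^+ 2 <= Z ^+ 58 * ypairs l).
have [/hasP[l lG /andP[h1 h2]]|/hasPn none] := boolP (has P G2).
  by exists l; [exact: G2_gt0 | split].
exfalso; have n2 : 0 < n ^+ 2 by rewrite exprn_gt0.
pose g : R := \sum_(a <- A) \sum_(b <- A) (good (a / b))%:R.
(* An [l] that fails is charged to its energy if that is too large, and otherwise to $Zn^2$ because
   it has too few [ypairs]. *)
have bound l : l \in G2 ->
    Z ^+ 52 * quads l <= Z * n ^+ 2 + energy A l.
  move=> lG; have q1 := quads_le (G2_gt0 lG).
  have y1 := ypairs_le l; have e0 := energy_ge0 A l.
  have q2 := ler_wpM2l (ltW (pw 52)) q1.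
  apply: (le_trans q2).
  rewrite (_ : Z ^+ 52 * (Z ^+ 7 * ypairs l) = Z ^+ 59 * ypairs l); last by ring.
  move: (none _ lG); rewrite negb_and -!ltNge => /orP[h|h].
    apply: le_trans (_ : Z ^+ 59 * n ^+ 2 <= _); first by rewrite ler_pM2l.
    by apply: (le_trans (ltW h)); rewrite lerDr mulr_ge0 // ltW.
  apply: le_trans (_ : Z * n ^+ 2 <= _); last by rewrite lerDl.
  rewrite (_ : Z ^+ 59 * _ = Z * (Z ^+ 58 * ypairs l)); last by ring.
  by rewrite ler_pM2l // ltW.
have := ler_sum_in bound; rewrite -mulr_sumr sum_quads -/g big_split /= sum_const_seq.
move=> h; have e := sum_energy_G2.
have h1 : Z ^+ 52 * (n ^+ 2 * g) <= 2 * (Z ^+ 51 * n ^+ 4).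
  apply: (le_trans h); rewrite (_ : 2 * _ = Z ^+ 50 * n ^+ 2 * (Z * n ^+ 2) +
    Z ^+ 51 * n ^+ 4); last by ring.
  apply: lerD e; apply: ler_wpM2r trp.
  by rewrite mulr_ge0 ?exprn_ge0 // ltW.
have h2 := half_good_pairs; rewrite -/g in h2.
have c0 : 0 < Z ^+ 51 * n ^+ 2 by rewrite mulr_gt0.
have h3 : Z * g <= 2 * n ^+ 2.
  rewrite -(ler_pM2l c0).
  rewrite (_ : _ * (Z * g) = Z ^+ 52 * (n ^+ 2 * g)); last by ring.
  by apply: (le_trans h1); rewrite le_eqVlt; apply/orP; left; apply/eqP; ring.
have g0 : 0 <= g by lra.
have := ler_wpM2r g0 z100; lra.
Qed.

Let diffs (l : R) : {fset R} :=
  [fset v in diffset A (dilate l A) |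
     has (fun a => has (fun a' => (v == a - l * a') && (a / (l * a') \in QA)) A) A].

Let diffsP l v : reflect
  (exists a a', [/\ a \in A, a' \in A, a / (l * a') \in QA & v = a - l * a'])
  (v \in diffs l).
Proof.
rewrite !inE /=; apply: (iffP andP) => [[_ /hasP[a aA /hasP[a' a'A /andP[/eqP e q]]]]|].
  by exists a, a'.
move=> [a [a' [aA a'A q ->]]]; split.
  by apply: mem_diffset => //; apply/dilateP; exists a'.
by apply/hasP; exists a => //; apply/hasP; exists a' => //; rewrite eqxx.
Qed.

(** Cauchy-Schwarz on the selected pairs, whose collisions are among those counted by the full
    energy. *)
Lemma card_diffs l : ypairs l ^+ 2 <= #|` diffs l|%:R * energy A l.
Proof.
pose s := [seq p <- [seq (a, a') | a <- A, a' <- A] | p.1 / (l * p.2) \in QA].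
pose f (p : R * R) := p.1 - l * p.2.
have fS : {in s, forall p, f p \in diffs l}.
  move=> p; rewrite mem_filter => /andP[q /allpairsP[[a a'] /= [aA a'A e]]].
  by apply/diffsP; exists a, a'; rewrite e in q *.
have -> : ypairs l = (size s)%:R by rewrite size_filter -sum_indicator big_allpairs.
apply: (le_trans (card_sqr_fibre R (fset_uniq _) fS)).
rewrite ler_wpM2l ?ler0n // energy_diff.
have -> : \sum_(a <- A) \sum_(b <- A) \sum_(c <- A) \sum_(d <- A)
    (a - l * b == c - l * d)%:R =
    \sum_(p <- [seq (a, a') | a <- A, a' <- A])
      \sum_(p' <- [seq (a, a') | a <- A, a' <- A]) (f p == f p')%:R :> R.
  rewrite big_allpairs; do 2 (apply: eq_bigr => ? _).
  by rewrite big_allpairs.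
rewrite /s big_filter [leLHS]big_mkcond; apply: ler_sum => p _.
case: ifP => _; last by apply: sumr_ge0 => ? _; apply: ler0n.
rewrite big_filter [leLHS]big_mkcond; apply: ler_sum => p' _.
by case: ifP => _ //; apply: ler0n.
Qed.

(** For the $l$ of [good_ratio_exists], the set $V$ of nonzero differences $a-la'$ has about $n^2$
    elements. It has small doubling because $V+V\subseteq(A+A)-l(A+A)$, and
    $V\cdot(A/A)\subseteq(AA/AA)(A-A)$ has size about $n^3$, that is, $|V||A/A|^{1/2}$. As $|V|$ far
    exceeds $|A/A|^{1/2}$, [large_set_doubling] bounds $|A/A|$, hence $n$. *)
Lemma small_set : n <= (Z ^+ 232) ^+ 1105.
Proof.
have z100 := Z100; have z0 := Z0; have np := n0.
(* $232=52+4+176$ collects the losses in the product bound for $V$: $Z^{52}$ from $|V\cdot(A/A)|$,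
   $Z^4$ from $n\le Z^4S$, and $Z^{176}$ from $n^2\le Z^{176}|V|$. *)
rewrite leNgt; apply/negP; set Y := Z ^+ 232 => nbig.
have Y1 : 1 <= Y by rewrite exprn_ege1 //; exact: Z1.
have Y0 : 0 < Y by exact: pw.
have ZY k : (k <= 232)%N -> Z ^+ k <= Y.
  by move=> k232; apply: ler_weXn2l => //; exact: Z1.
have Y100 : 100 <= Y by apply: (le_trans z100); rewrite -[Z]expr1 ZY.
have nY k : (k <= 1105)%N -> Y ^+ k <= n.
  by move=> k1105; apply: ltW; apply: le_lt_trans nbig; apply: ler_weXn2l.
have n1 : 1 <= n by have := nY 0%N isT; rewrite expr0.
have [l l0 [lG [El yl]]] := good_ratio_exists.
have n2 : 0 < n ^+ 2 by rewrite exprn_gt0.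
have diffs_ge : n ^+ 2 <= Z ^+ 175 * #|` diffs l|%:R.
  rewrite -(ler_pM2r n2).
  apply: le_trans (_ : (Z ^+ 58 * ypairs l) ^+ 2 <= _).
    rewrite -expr2 ler_pXn2r // nnegrE ?(ltW n2) //.
    exact: le_trans (ltW n2) yl.
  rewrite exprMn -exprM; apply: (le_trans (ler_wpM2l (ltW (pw _)) (card_diffs l))).
  apply: le_trans (_ : Z ^+ (58 * 2) * (#|` diffs l|%:R * (Z ^+ 59 * n ^+ 2)) <= _).
    by rewrite ler_pM2l // ler_wpM2l ?ler0n.
  by rewrite le_eqVlt; apply/orP; left; apply/eqP; ring.
pose V := diffs l `\ 0.
have VD v : v \in V -> v \in diffs l by rewrite in_fsetD1 => /andP[].
have cV : #|` diffs l|%:R <= #|` V|%:R + 1 :> R.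
  rewrite natr1 ler_nat (cardfsD1 0 (diffs l)) -/V.
  by case: (_ \in _) => //=; rewrite ?add0n // add1n.
have V_ge : n ^+ 2 <= Z ^+ 176 * #|` V|%:R.
  have h1 : n ^+ 2 <= Z ^+ 175 * #|` V|%:R + Z ^+ 175.
    apply: (le_trans diffs_ge); rewrite -[X in _ + X]mulr1 -mulrDr.
    by apply: ler_wpM2l => //; apply: ltW.
  have h2 : 2 * Z ^+ 175 <= n ^+ 2.
    apply: le_trans (_ : Y * n <= _); last first.
      by rewrite expr2 ler_pM2r // -[Y]expr1 nY.
    apply: le_trans (_ : Y * Y <= _); last by rewrite ler_pM2l // -[Y in leLHS]expr1 nY.
    by apply: ler_pM => //; [exact: ltW | lra | exact: ZY].
  have h3 : 0 <= Z ^+ 175 * #|` V|%:R by rewrite mulr_ge0 ?ler0n // ltW.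
  have h4 := ler_wpM2r h3 z100.
  rewrite (_ : Z ^+ 176 * _ = Z * (Z ^+ 175 * #|` V|%:R)); last by ring.
  move: h1 h2 h3 h4; set X := Z ^+ 175 * _; set X' := Z ^+ 175; move=> *; lra.
have dblV : #|` sumset V V|%:R <= Y * #|` V|%:R.
  pose S2 := sumset A A.
  have sub : sumset V V `<=` [fset x - l * y | x in S2, y in S2].
    apply/fsubsetP => x /sumsetP[v [w [/VD /diffsP[a [a' [aA a'A _ ->]]]
      /VD /diffsP[b [b' [bA b'A _ ->]]] ->]]].
    apply/imfset2P; exists (a + b) => /=; first exact: mem_sumset.
    by exists (a' + b') => /=; [exact: mem_sumset | ring].
  have h1 : #|` sumset V V|%:R <= (Z * n) ^+ 2.
    apply: le_trans (_ : #|` S2|%:R ^+ 2 <= _).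
      rewrite expr2 -natrM ler_nat.
      exact: leq_trans (fsubset_leq_card sub) (card_image2_le _ _ _).
    by rewrite ler_pXn2r // nnegrE ?ler0n // mulr_ge0 // ltW.
  apply: (le_trans h1); rewrite exprMn.
  apply: (le_trans (ler_wpM2l (ltW (pw 2)) V_ge)); rewrite mulrA -exprD.
  by apply: ler_wpM2r; rewrite ?ler0n ?ZY.
pose S : R := Num.sqrt #|` QA|%:R.
have QAc := card_quotset_self.
have QA0 : 0 < #|` QA|%:R :> R.
  by rewrite -(pmulr_rgt0 _ (pw 8)); apply: lt_le_trans QAc.
have S0 : 0 < S by rewrite sqrtr_gt0.
have SN : S ^+ 2 = #|` QA|%:R by rewrite sqr_sqrtr // ltW.
have S_le : S <= n.
  rewrite -(@ler_pXn2r _ 2) // ?nnegrE ?(ltW S0) ?(ltW np) //.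
  by rewrite SN expr2 -natrM ler_nat card_image2_le.
have S_ge : n <= Z ^+ 4 * S.
  have ZS : 0 <= Z ^+ 4 * S by rewrite mulr_ge0 // ltW.
  rewrite -(@ler_pXn2r _ 2) // ?nnegrE ?(ltW np) //.
  by rewrite (_ : (Z ^+ 4 * S) ^+ 2 = Z ^+ 8 * S ^+ 2); [rewrite SN | ring].
have prdV : #|` prodset V QA|%:R <= Y * S * #|` V|%:R.
  have sub : prodset V QA `<=` prodset G2 (diffset A A).
    apply/fsubsetP => x /prodsetP[v [w [/VD /diffsP[a [a' [aA a'A
      /quotsetP[b [b' [bA b'A e]]] ->]]] /quotsetP[c [c' [cA c'A ->]]] ->]]].
    have bn0 := A0 bA; have b'n0 := A0 b'A; have c'n0 := A0 c'A.
    have an0 := A0 aA; have a'n0 := A0 a'A; have ln0 := neq0 l0.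
    (* This turns $(a-la')\cdot c/c'$ into $\frac{ac}{bc'}(b-b')$, an element of $(AA/AA)(A-A)$. *)
    have e' : l * a' = a * b' / b.
      apply: (mulfI (_ : b / b' != 0)); first by rewrite mulf_neq0 ?invr_eq0.
      by rewrite -{1}e; field; rewrite ?bn0 ?b'n0 ?ln0 ?a'n0.
    have -> : (a - l * a') * (c / c') = (a * c) / (b * c') * (b - b').
      by rewrite e'; field; rewrite bn0 c'n0.
    by apply: mem_prodset; [apply: mem_quotset; apply: mem_prodset | apply: mem_diffset].
  have hD : #|` diffset A A|%:R <= Z ^+ 2 * n.
    rewrite -(ler_pM2r np) -natrM.
    apply: le_trans (_ : #|` sumset A A|%:R ^+ 2 <= _).
      by rewrite expr2 -natrM ler_nat ruzsa.
    rewrite (_ : Z ^+ 2 * n * n = (Z * n) ^+ 2); last by ring.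
    by rewrite ler_pXn2r // nnegrE ?ler0n // mulr_ge0 // ltW.
  have h1 : #|` prodset V QA|%:R <= (Z ^+ 50 * n ^+ 2) * (Z ^+ 2 * n).
    apply: le_trans (_ : #|` G2|%:R * #|` diffset A A|%:R <= _); last first.
      by apply: ler_pM; rewrite ?ler0n.
    rewrite -natrM ler_nat.
    exact: leq_trans (fsubset_leq_card sub) (card_image2_le _ _ _).
  apply: (le_trans h1).
  have c0 : 0 <= Z ^+ 52 by exact: ltW.
  rewrite (_ : Z ^+ 50 * n ^+ 2 * (Z ^+ 2 * n) = Z ^+ 52 * (n * n ^+ 2));
    last by ring.
  apply: le_trans (_ : Z ^+ 52 * ((Z ^+ 4 * S) * (Z ^+ 176 * #|` V|%:R)) <= _).
    by apply: ler_wpM2l => //; apply: ler_pM => //; apply: ltW.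
  by rewrite /Y le_eqVlt; apply/orP; left; apply/eqP; ring.
have largeV : Y ^+ 11 * S <= #|` V|%:R.
  rewrite -(ler_pM2l (pw 176)); apply: le_trans V_ge.
  rewrite expr2 mulrA; apply: ler_pM => //; first by rewrite mulr_ge0 ?exprn_ge0 // ltW.
    exact: ltW.
  apply: le_trans (nY 12 isT); rewrite [Y ^+ 12]exprS.
  by apply: ler_wpM2r; [rewrite exprn_ge0 // ltW | exact: ZY].
have QApos : {in QA, forall b, 0 < b} by move=> b /QA_gt0.
have V0 : 0 \notin V by rewrite in_fsetD1 eqxx.
have := large_set_doubling Y100 S0 SN V0 QApos dblV prdV largeV => QAle.
move: nbig; apply/negP; rewrite -leNgt.
apply: le_trans (_ : n ^+ 2 <= _); first by rewrite expr2 -{1}[n]mul1r ler_pM2r.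
apply: (le_trans QAc); rewrite [Y ^+ 1105]exprS; apply: ler_pM => //; first exact: ltW.
exact: ZY.
Qed.

End SmallSet.

(** * Combining the two cases, removing signs, and balancing against K *)

Section Assembly.
Variable R : realType.
Implicit Types (A B : {fset R}) (Z : R).

Lemma card_prodset_ge A B : A != fset0 -> {in A, forall a, a != 0} ->
  (#|` B| <= #|` prodset A B|)%N.
Proof.
move=> /fset0Pn[a aA] A0; rewrite -(size_map (fun b => a * b)).
apply: uniq_leq_size; first by rewrite map_inj_uniq ?fset_uniq //; apply/mulfI/A0.
by move=> x /mapP[b bB ->]; apply: mem_prodset.
Qed.

(** If $|A|<Z^{11}S$, then $|AB|\le Z^{12}|B|$, so [card_quot_prod] gives $|AA/AA|\le Z^{48}|B|$;
    and $|B|\le|AB|$ gives $S\le Z|A|$, hence $|B|\le Z^2|A|^2$. This is the input of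
    [small_set]. *)
Lemma small_product_bound : exists m : nat, forall Z A B, 100 <= Z ->
  {in A, forall a, 0 < a} -> {in B, forall b, 0 < b} ->
  A != fset0 -> B != fset0 -> #|` sumset A A|%:R <= Z * #|` A|%:R ->
  #|` prodset A B|%:R <= Z * Num.sqrt #|` B|%:R * #|` A|%:R ->
  #|` B|%:R <= Z ^+ m.
Proof.
(* The exponent is kept opaque so that this product is never computed in unary. *)
have [e eE] : exists e, e = (232 * 1105)%N by eexists.
exists (1104 + (2 + e * 2))%N.
move=> Z A B Z100 Apos Bpos A0 B0 dbl prd.
have Z0 : 0 < Z by lra.
have Z1 : 1 <= Z by lra.
have pw k : 0 < Z ^+ k by rewrite exprn_gt0.
have n0 : 0 < #|` A|%:R :> R by rewrite ltr0n cardfs_gt0.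
have N0 : 0 < #|` B|%:R :> R by rewrite ltr0n cardfs_gt0.
set S : R := Num.sqrt _ in prd.
have S0 : 0 < S by rewrite sqrtr_gt0.
have SN : S ^+ 2 = #|` B|%:R by rewrite sqr_sqrtr // ltW.
have nz (C : {fset R}) : {in C, forall a, 0 < a} -> {in C, forall a, a != 0}.
  by move=> Cpos a /Cpos; rewrite lt_def => /andP[].
clearbody S.
have [large|small] := leP (Z ^+ 11 * S) #|` A|%:R.
  have zA : 0 \notin A by apply/negP => /Apos; rewrite ltxx.
  apply: le_trans (large_set_doubling Z100 S0 SN zA Bpos dbl prd large) _.
  by apply: ler_weXn2l; rewrite ?leq_addr.
have SZn : S <= Z * #|` A|%:R.
  rewrite -(ler_pM2l S0) -expr2 SN.
  apply: le_trans (_ : #|` prodset A B|%:R <= _).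
    by rewrite ler_nat card_prodset_ge //; apply: nz.
  by apply: (le_trans prd); rewrite le_eqVlt; apply/orP; left; apply/eqP; ring.
have N_le : #|` B|%:R <= Z ^+ 2 * #|` A|%:R ^+ 2.
  by rewrite -SN -exprMn ler_pXn2r // nnegrE ?ltW // mulr_gt0.
have prd2 : #|` prodset A B|%:R <= Z ^+ 12 * #|` B|%:R.
  apply: (le_trans prd); have ZS : 0 < Z * S by rewrite mulr_gt0.
  apply: le_trans (ler_wpM2l (ltW ZS) (ltW small)) _.
  by rewrite -SN le_eqVlt; apply/orP; left; apply/eqP; ring.
have trp := card_quot_prod Apos Bpos B0 (ltW (pw 12)) prd2.
have {}trp : #|` quotset (prodset A A) (prodset A A)|%:R <=
    Z ^+ 50 * #|` A|%:R ^+ 2.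
  apply: (le_trans trp); rewrite -exprM.
  apply: (le_trans (ler_wpM2l (ltW (pw _)) N_le)).
  by rewrite le_eqVlt; apply/orP; left; apply/eqP; ring.
have nle : #|` A|%:R <= Z ^+ e.
  by rewrite eE exprM; apply: small_set Z100 Apos n0 dbl trp.
apply: (le_trans N_le); apply: le_trans (_ : Z ^+ (2 + e * 2) <= _); last first.
  by apply: ler_weXn2l; rewrite ?leq_addl.
rewrite exprD ler_pM2l // exprM ler_pXn2r // ?nnegrE ?ler0n //.
exact: ltW (pw e).
Qed.

(** Take the larger of the positive part and the reflected negative part; [e] is the sign. It is
    nonempty, so zero and the other part cost at most a factor 3. *)
Lemma positive_part A : A != fset0 -> A <> [fset 0] ->
  exists e A0, [/\ e != 0, {in A0, forall a, 0 < a}, A0 != fset0,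
    (#|` A| <= 4 * #|` A0|)%N & dilate e A0 `<=` A].
Proof.
move=> An0 Ane.
pose P := [fset a in A | 0 < a]; pose M := [fset - a | a in [fset a in A | a < 0]].
have MP x : (x \in M) = (- x \in A) && (0 < x).
  apply/imfsetP/andP => [[a /=]|[xA x0]].
    by rewrite !inE => /andP[aA a0] ->; rewrite opprK oppr_gt0.
  by exists (- x); rewrite ?opprK //= !inE xA oppr_lt0.
have cA : (#|` A| <= #|` P| + #|` M| + 1)%N.
  have sub : A `<=` P `|` dilate (-1) M `|` [fset 0].
    apply/fsubsetP => a aA; rewrite !inE aA /=.
    case: (ltgtP 0 a) => // a0; rewrite ?orbT // orbF /=.
    by apply/dilateP; exists (- a); rewrite ?MP ?opprK ?aA ?oppr_gt0 // mulN1r opprK.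
  apply: leq_trans (fsubset_leq_card sub) _.
  apply: leq_trans (leq_card_fsetU _ _) _; rewrite cardfs1 leq_add2r.
  apply: leq_trans (leq_card_fsetU _ _) _.
  by rewrite card_dilate // oppr_eq0 oner_eq0.
have PM : (0 < #|` P| + #|` M|)%N.
  rewrite lt0n addn_eq0; apply/negP => /andP[/eqP/cardfs0_eq P0 /eqP/cardfs0_eq M0].
  apply: Ane; have sub : A `<=` [fset 0].
    apply/fsubsetP => a aA; rewrite inE; case: (ltgtP a 0) => // a0.
      by have := MP (- a); rewrite M0 inE opprK aA oppr_gt0 a0.
    have : a \in P by rewrite !inE aA.
    by rewrite P0 inE.
  by move: sub; rewrite fsubset1 (negbTE An0) orbF => /eqP.
have [le|lt] := leqP #|` M| #|` P|.
  have [P0 P4] : (0 < #|` P|)%N /\ (#|` A| <= 4 * #|` P|)%N.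
    by move: le PM cA; move: #|` P| #|` M| #|` A| => p q r; lia.
  exists 1, P; split; rewrite ?oner_eq0 //.
  - by move=> a; rewrite !inE => /andP[].
  - by rewrite -cardfs_gt0.
  by apply/fsubsetP => x /dilateP[a]; rewrite !inE => /andP[aA _] ->; rewrite mul1r.
have [M0 M4] : (0 < #|` M|)%N /\ (#|` A| <= 4 * #|` M|)%N.
  by move: lt PM cA; move: #|` P| #|` M| #|` A| => p q r; lia.
exists (-1), M; split; rewrite ?oppr_eq0 ?oner_eq0 //.
- by move=> a; rewrite MP => /andP[].
- by rewrite -cardfs_gt0.
by apply/fsubsetP => x /dilateP[a]; rewrite MP => /andP[aA _] ->; rewrite mulN1r.
Qed.

Lemma prodset_dilate (e f : R) A B :
  dilate (e * f) (prodset A B) `<=` prodset (dilate e A) (dilate f B).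
Proof.
apply/fsubsetP => x /dilateP[_ /prodsetP[a [b [aA bB ->]]] ->].
rewrite mulrACA; apply: mem_prodset; apply/dilateP; [by exists a | by exists b].
Qed.

(** [elekes] with $U=AB$, $G=B$ and $q=|A|$. If $|A|<4$, the trivial $|B|\le|AB|$ is enough. *)
Lemma elekes_product A B (K : R) : {in A, forall a, a != 0} ->
  {in B, forall b, b != 0} -> A != fset0 -> 1 <= K ->
  #|` sumset A A|%:R <= K * #|` A|%:R ->
  #|` A|%:R * Num.sqrt #|` B|%:R <= 9 * K * #|` prodset A B|%:R.
Proof.
move=> A0 B0 An0 K1 dbl.
set n := #|` A|%:R in dbl *; set X := #|` prodset A B|%:R.
set S : R := Num.sqrt _.
have n0 : 0 < n by rewrite ltr0n cardfs_gt0.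
have S0 : 0 <= S by apply: sqrtr_ge0.
have SN : S ^+ 2 = #|` B|%:R by rewrite sqr_sqrtr ?ler0n.
have X0 : 0 <= X by apply: ler0n.
have NX : S ^+ 2 <= X by rewrite SN ler_nat card_prodset_ge.
clearbody S; have [n4|n4] := leP 4 n; last first.
  have S1 : S <= S ^+ 2.
    have [Be|Bn0] := eqVneq B fset0.
      have : S ^+ 2 == 0 by rewrite SN Be cardfs0.
      by rewrite expf_eq0 /= => /eqP ->; rewrite expr0n.
    have : 1 <= S ^+ 2 by rewrite SN ler1n cardfs_gt0.
    by rewrite expr2 => h; rewrite -[leLHS]mulr1 ler_wpM2l //; nra.
  apply: le_trans (_ : 4 * X <= _).
    by apply: ler_pM; rewrite ?(ltW n0) ?(ltW n4) // (le_trans S1 NX).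
  by apply: ler_wpM2r => //; lra.
have rich : {in B, forall b, n <= \sum_(a <- A) (b * a \in prodset A B)%:R}.
  move=> b bB; rewrite -[leLHS]mulr1 /n; apply: sum_ge_const => a aA.
  by rewrite [b * a]mulrC mem_prodset.
have := elekes (fset_uniq B) B0 n4 rich; rewrite -/n -SN -/X => h.
have KX : 0 <= 9 * K * X by rewrite !mulr_ge0 //; lra.
rewrite -(@ler_pXn2r _ 2) ?nnegrE ?mulr_ge0 ?(ltW n0) //; last by lra.
have n2 : 0 < n ^+ 2 by rewrite exprn_gt0.
rewrite -(ler_pM2r n2).
rewrite (_ : (n * S) ^+ 2 * n ^+ 2 = S ^+ 2 * n * n ^+ 3); last by ring.
apply: (le_trans h).
rewrite (_ : (9 * K * X) ^+ 2 * n ^+ 2 = 81 * (K * n) ^+ 2 * X ^+ 2); last by ring.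
apply: ler_wpM2r; first by rewrite exprn_ge0.
rewrite ler_pM2l // ler_pXn2r // nnegrE ?ler0n // mulr_ge0 ?(ltW n0) //; lra.
Qed.

(** The numerical end of the proof: [n1], [N1], [Y] stand for the sizes of the positive parts and of
    their product set. With $\nu=N^k$, three regimes cover everything: $K>\nu^3$; $K\le\nu^3$ with
    $Y$ large; and $N$ bounded by the constant $C$. *)
Lemma combine_bounds (m : nat) (n N n1 N1 K X Y : R) :
  let k := (6 * m.+1%:R)^-1 in
  1 <= n -> 1 <= N -> 0 < n1 -> 1 <= N1 -> 1 <= K ->
  n <= 4 * n1 -> N <= 4 * N1 -> 0 <= X -> Y <= X ->
  n1 * Num.sqrt N1 <= 36 * K * Y ->
  (forall Z, 100 <= Z -> 4 * K <= Z -> Y <= Z * Num.sqrt N1 * n1 ->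
     N1 <= Z ^+ m) ->
  (288 * (16 * 400 ^+ (2 * m)))^-1 * (n * N `^ (1 / 2 + k) / K `^ (4 / 3)) <= X.
Proof.
move=> k n_ge N_ge n1p N1_ge K1 n4 N4 X0 YX weak bound.
have [C CE] : exists C : R, C = 16 * 400 ^+ (2 * m) by eexists.
have C1 : 1 <= C.
  have h : 1 <= 400 ^+ (2 * m) :> R by rewrite exprn_ege1 //; clear; lra.
  by rewrite CE; apply: le_trans (ler_wpM2l _ h) => //; clear; lra.
rewrite -CE.
have N0 : 0 < N by clear -N_ge; lra.
have Kp : 0 < K by clear -K1; lra.
have m0 : 0 < m.+1%:R :> R by rewrite ltr0n.
have k0 : 0 < k by rewrite invr_gt0 mulr_gt0.
set S1 : R := Num.sqrt N1 in weak bound.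
have S1p : 1 <= S1 by rewrite -sqrtr1 ler_wsqrtr.
have S1N : S1 ^+ 2 = N1 by rewrite sqr_sqrtr // (le_trans ler01).
have [S [SE Sp SN]] : exists S : R, [/\ S = N `^ 2^-1, 1 <= S & S ^+ 2 = N].
  exists (Num.sqrt N); rewrite powR12_sqrt ?(ltW N0) // sqr_sqrtr ?(ltW N0) //.
  by split=> //; rewrite -sqrtr1 ler_wsqrtr.
clearbody S1.
have SS : S <= 2 * S1.
  rewrite -(@ler_pXn2r _ 2) // ?nnegrE; [|clear -Sp; lra|clear -S1p; lra].
  by rewrite exprMn SN S1N; apply: (le_trans N4); clear; lra.
have nS : n * S <= 8 * (n1 * S1).
  have -> : 8 * (n1 * S1) = (4 * n1) * (2 * S1) by ring.
  by apply: ler_pM => //; [clear -n_ge | clear -Sp]; lra.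
have KY : n * S <= 288 * K * X.
  apply: (le_trans nS); have -> : 288 * K * X = 8 * (36 * K * X) by ring.
  apply: ler_wpM2l => //; apply: (le_trans weak).
  by apply: ler_wpM2l YX; clear -Kp; lra.
have [nu nuE] : exists nu, nu = N `^ k by eexists.
have nu1 : 1 <= nu by have := ler_powR N_ge (ltW k0); rewrite powRr0 -nuE.
have -> : N `^ (1 / 2 + k) = S * nu.
  rewrite powRD; last by apply/implyP => _; rewrite gt_eqF.
  by rewrite SE nuE div1r.
have [L LE] : exists L, L = K `^ (4 / 3) by eexists.
have KL : K <= L by rewrite LE le1r_powR //; clear; lra.
have L0 : 0 < L by clear -KL Kp; lra.
have nu3 : 1 <= nu ^+ 3 by rewrite exprn_ege1.
rewrite -LE ler_pdivrMl; last by clear -C1; lra.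
rewrite ler_pdivrMr // mulrA.
(* For $K>\nu^3$ the gain $\nu$ is below $K^{1/3}$, so Elekes's bound with its factor $K$ becomes
   the claim with $K^{4/3}$. *)
have [Knu|Knu] := leP K (nu ^+ 3); last first.
  have KnuL : K * nu <= L.
    have e : 4 / 3 = 1 + 3^-1 :> R by field.
    rewrite LE e powRD; last by apply/implyP => _; rewrite gt_eqF.
    rewrite powRr1 ?(ltW Kp) // ler_pM2l //.
    have -> : nu = (nu ^+ 3) `^ 3^-1.
      rewrite -powR_mulrn ?(le_trans ler01 nu1) // -powRrM.
      by rewrite mulfV ?pnatr_eq0 // powRr1 // (le_trans ler01 nu1).
    have nu30 : 0 <= nu ^+ 3 by apply: le_trans nu3.
    by apply: ge0_ler_powR; rewrite ?nnegrE ?invr_ge0 // ltW.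
  apply: le_trans (_ : 288 * X * (K * nu) <= _).
    have -> : 288 * X * (K * nu) = 288 * K * X * nu by ring.
    by apply: ler_wpM2r KY; clear -nu1; lra.
  apply: ler_pM KnuL.
  - by clear -X0; lra.
  - by rewrite mulr_ge0 //; [clear -Kp | clear -nu1]; lra.
  - by apply: ler_wpM2r => //; clear -C1; lra.
(* $Z=400\nu^3$ exceeds both 100 and $4K$. If $Y$ is small, [bound] applies, and $k$ is chosen so
   that $\nu^{3m}\le N^{1/2}$; hence $N\le4\cdot400^mN^{1/2}$ and $N\le C$. *)
have [small|big] := leP Y (400 * nu ^+ 3 * S1 * n1); last first.
  have h1 : n * S * nu <= X.
    apply: le_trans (ltW (lt_le_trans big YX)).
    apply: le_trans (_ : 8 * (n1 * S1) * nu <= _).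
      by apply: ler_wpM2r => //; clear -nu1; lra.
    have -> : 400 * nu ^+ 3 * S1 * n1 = n1 * S1 * (400 * nu ^+ 3) by ring.
    have -> : 8 * (n1 * S1) * nu = n1 * S1 * (8 * nu) by ring.
    apply: ler_wpM2l; first by rewrite mulr_ge0 ?(ltW n1p) //; clear -S1p; lra.
    apply: ler_pM; [clear; lra | clear -nu1; lra | clear; lra |].
    by rewrite -{1}[nu]expr1 ler_weXn2l.
  have c1 : 1 <= 288 * C * L.
    apply: le_trans (_ : 1 * 1 <= _); first by rewrite mulr1.
    by apply: ler_pM; rewrite ?ler01 ?(le_trans K1 KL) //; clear -C1; lra.
  apply: (le_trans h1); have -> : 288 * C * X * L = 288 * C * L * X by ring.
  by rewrite -[leLHS]mul1r; apply: ler_wpM2r.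
have Z100 : 100 <= 400 * nu ^+ 3 by clear -nu3; lra.
have KZ : 4 * K <= 400 * nu ^+ 3 by clear -Knu K1; lra.
have N1le := bound _ Z100 KZ small.
have km : k * (3 * m)%:R <= 2^-1.
  rewrite /k mulrC ler_pdivrMr ?mulr_gt0 // natrM -[m.+1%:R]natr1.
  by clear; lra.
have nuS : nu ^+ 3 ^+ m <= S.
  have -> : nu ^+ 3 ^+ m = N `^ (k * (3 * m)%:R).
    by rewrite powRrM -nuE powR_mulrn ?exprM // (le_trans ler01).
  by rewrite SE ler_powR.
have SC : S <= 4 * 400 ^+ m.
  have S0 : 0 < S by clear -Sp; lra.
  rewrite -(ler_pM2r S0) -expr2 SN; apply: (le_trans N4).
  rewrite -[leRHS]mulrA ler_pM2l //; apply: (le_trans N1le).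
  rewrite exprMn; apply: ler_wpM2l nuS.
  by rewrite exprn_ge0.
have NC : N <= C.
  have -> : C = (4 * 400 ^+ m) ^+ 2.
    by rewrite CE exprMn -exprM mulnC; congr (_ * _); ring.
  rewrite -SN ler_pXn2r // nnegrE; first by clear -Sp; lra.
  by apply: le_trans SC; clear -Sp; lra.
have nuN : nu <= C.
  apply: le_trans NC; rewrite nuE; apply: ler1_powR => //.
  rewrite /k invf_le1 ?mulr_gt0 //; have := ler0n R m; rewrite -[m.+1%:R]natr1.
  by clear; lra.
apply: le_trans (_ : 288 * K * X * C <= _).
  apply: ler_pM => //; last by clear -nu1; lra.
  by rewrite mulr_ge0 //; [clear -n_ge | clear -Sp]; lra.
have -> : 288 * K * X * C = 288 * C * X * K by ring.
by apply: ler_wpM2l KL; rewrite mulr_ge0 //; clear -C1; lra.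
Qed.

End Assembly.

(** The set $A=\{0\}$ is excluded because then $|AB|=1$ while $K=1$ and $|B|$ is unbounded. The
    constant [c] is chosen before [kappa], so it is uniform. *)
Theorem theorem4 (R : realType) :
  exists c : R, 0 < c /\
    forall kappa : R, 0 < kappa ->
      exists k : R, 0 < k /\
        forall (A B : {fset R}) (K : R),
          A <> [fset 0] ->
          #|` A|%:R `^ kappa <= #|` B|%:R ->
          #|` sumset A A|%:R = K * #|` A|%:R ->
          c * (#|` A|%:R * #|` B|%:R `^ (1 / 2 + k) / K `^ (4 / 3))
            <= #|` prodset A B|%:R.
Proof.
have [m bound] := small_product_bound R.
exists (288 * (16 * 400 ^+ (2 * m)))^-1; split.
  by rewrite invr_gt0 !pmulr_rgt0 ?exprn_gt0 //; lra.
move=> kappa kappa0; exists (6 * m.+1%:R)^-1; split.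
  by rewrite invr_gt0 pmulr_rgt0 ?ltr0n.
move=> A B K Ane size_le dbl.
have [->|A0] := eqVneq A fset0; first by rewrite cardfs0 !mul0r mulr0 ler0n.
have n1 : 1 <= #|` A|%:R :> R by rewrite ler1n cardfs_gt0.
have n0 : 0 < #|` A|%:R :> R by apply: lt_le_trans n1.
have N1 : 1 <= #|` B|%:R :> R.
  apply: le_trans size_le; have := ler_powR n1 (ltW kappa0).
  by rewrite powRr0.
have B0 : B != fset0 by rewrite -cardfs_gt0 -(ler1n R).
have K1 : 1 <= K.
  by rewrite -(ler_pM2r n0) mul1r -dbl ler_nat card_sumset_ge.
have X0 : 0 <= #|` prodset A B|%:R :> R by apply: ler0n.
have nz (D : {fset R}) : {in D, forall a, 0 < a} -> {in D, forall a, a != 0}.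
  by move=> Dpos a /Dpos; rewrite lt_def => /andP[].
have [e [A1 [e0 A1pos A1n0 cA A1A]]] := positive_part A0 Ane.
have n1p : 0 < #|` A1|%:R :> R by rewrite ltr0n cardfs_gt0.
have cA' : #|` A|%:R <= 4 * #|` A1|%:R :> R by rewrite -natrM ler_nat.
have dbl1 : #|` sumset A1 A1|%:R <= 4 * K * #|` A1|%:R.
  apply: le_trans (_ : #|` sumset A A|%:R <= _).
    rewrite ler_nat -(card_dilate (sumset A1 A1) e0) -sumset_dilate.
    exact/fsubset_leq_card/sumsetS.
  rewrite dbl; have -> : 4 * K * #|` A1|%:R = K * (4 * #|` A1|%:R) by ring.
  by apply: ler_wpM2l cA'; apply: le_trans K1.
have K4 : 1 <= 4 * K by lra.
(* For $B=\{0\}$ there is no positive part; the size condition then forces $|A|=1$, and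
   [combine_bounds] is applied with [n1], [N1] and [Y] all equal to 1. *)
have [Bz|Bne] := eqVneq B [fset 0].
  have nle : #|` A|%:R = 1 :> R.
    apply/eqP; rewrite eq_le n1 andbT leNgt; apply/negP => ngt.
    have := size_le; rewrite Bz cardfs1 leNgt => /negP; apply.
    have := @gt0_ltr_powR R kappa kappa0 1 #|` A|%:R.
    by rewrite powR1; apply; rewrite ?nnegrE.
  have X1 : 1 <= #|` prodset A B|%:R :> R.
    rewrite ler1n cardfs_gt0; apply/fset0Pn; have [a aA] := fset0Pn _ A0.
    by exists (a * 0); rewrite mem_prodset // Bz inE.
  apply: (@combine_bounds R m _ _ 1 1 K _ 1) => //.
  - by rewrite nle; lra.
  - by rewrite Bz cardfs1; lra.
  - by rewrite sqrtr1; lra.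
  - by move=> Z Z100 _ _; rewrite exprn_ege1 //; lra.
have [f [B1 [f0 B1pos B1n0 cB B1B]]] := positive_part B0 (elimN eqP Bne).
apply: (@combine_bounds R m _ _ #|` A1|%:R #|` B1|%:R K _ #|` prodset A1 B1|%:R) => //.
- by rewrite ler1n cardfs_gt0.
- by rewrite -natrM ler_nat.
- rewrite ler_nat -(card_dilate (prodset A1 B1) (mulf_neq0 e0 f0)).
  exact: leq_trans (fsubset_leq_card (prodset_dilate _ _ _ _))
    (fsubset_leq_card (prodsetS A1A B1B)).
- have := elekes_product (nz _ A1pos) (nz _ B1pos) A1n0 K4 dbl1.
  by have -> : 9 * (4 * K) = 36 * K by ring.
move=> Z Z100 KZ small; apply: (bound Z A1 B1) => //.
by apply: (le_trans dbl1); apply: ler_wpM2r KZ; apply: ltW.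
Qed.
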